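(* Let $X=X(\sigma,\tau)$ be a square-tiled surface with $\sigma,\tau\in S_n$. Put $\mathsf{Code}^L(Veech^+(X))=\{\mathsf{Code}^L(A)\mid A\in Veech^+(X)\}$, with the operation $\mathsf{Code}^L(A)\odot\mathsf{Code}^L(B)=\mathsf{Code}^L(AB)$ for $A,B\in Veech^+(X)$. Then $(\mathsf{Code}^L(Veech^+(X)),\odot)$ is a group, and the map $$\Phi:G_X/S_X\to\mathsf{Code}^L(Veech^+(X)),\qquad [u]\mapsto u\,\mathsf{Code}^L(I)\,u^{-1},$$ is a group isomorphism.
   Context: Permutations are multiplied left to right: $\alpha\beta$ means apply $\alpha$ first, then $\beta$. Square-tiled surface: for $\sigma,\tau\in S_n$, $X(\sigma,\tau)$ is obtained from $n$ unit squares $Q_1,\dots,Q_n$ (sides parallel to the axes) by gluing, via translations, the right side of $Q_i$ to the left side of $Q_{\sigma(i)}$ and the top side of $Q_i$ to the bottom side of $Q_{\tau(i)}$. The images of corners of squares are the marked points. The map of $X$ to the unit square torus pulls back $dz$ to a holomorphic 1-form on $X$; its zeros are marked points (those of total angle $>2\pi$), and away from them $X$ has a translation structure. Rational numbers and saddle connections: a ''rational number'' $\frac pq$ means that $(q,p)$ is a coprime pair of positive integers or $(q,p)\in\{(1,0),(0,1)\}$ (so $0=\frac01$ and $\infty=\frac10$ are allowed). For $r=\frac pq$ and $i\in\{1,\dots,n\}$, $\gamma_i$ is the straight segment on $X$ with displacement $(q,p)$ starting at the south-west corner of $Q_i$: if $r\notin\{0,\infty\}$ it begins inside $Q_i$;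 if $r=0$ it is the bottom side of $Q_i$; if $r=\infty$ it is the left side of $Q_i$. The complement of $\gamma_1\cup\dots\cup\gamma_n$ is a disjoint union of open Euclidean cylinders. $\gamma_i$ is a left boundary of the cylinder $C$ if $C$ lies on the left-hand side when walking along $\gamma_i$ in direction $(q,p)$. Left code: $\mathsf{Code}^L(r)\in S_n$ is defined by $\mathsf{Code}^L(r)(i)=k$ if, $C$ being the cylinder having $\gamma_i$ as a left boundary, the next left boundary of $C$ met after $\gamma_i$ when walking in direction $(q,p)$ along the boundary of $C$ is $\gamma_k$. (With these conventions $\mathsf{Code}^L(0)=\sigma$ and $\mathsf{Code}^L(\infty)=\sigma^{-1}\tau\sigma$.) Matrices: $SL_2^+(\mathbb{Z})$ is the set of matrices in $SL_2(\mathbb{Z})$ with all entries nonnegative. For $A=\begin{bmatrix} a&c\\ b&d\end{bmatrix}\in SL_2^+(\mathbb{Z})$, $\mathsf{Code}^L(A):=\left(\mathsf{Code}^L\left(\frac ba\right),\mathsf{Code}^L\left(\frac dc\right)\right)$. For a pair, $\alpha(\omega_1,\omega_2)\alpha^{-1}:=(\alpha\omega_1\alpha^{-1},\alpha\omega_2\alpha^{-1})$. $I$ is the identity matrix. Veech group: an affine diffeomorphism of $X$ is an orientation-preserving homeomorphism $f$ of $X$ that preserves the set of zeros of the 1-form, is a diffeomorphism off that set, and there has constant derivative (in the translation structure) equal to a matrix of $SL_2(\mathbb{Z})$. $Veech(X)$ is the group of derivatives of affine diffeomorphisms of $X$, and $Veech^+(X)=Veech(X)\cap SL_2^+(\mathbb{Z})$.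 Groups: $G_X=\{\omega\in S_n\mid \omega\,\mathsf{Code}^L(I)\,\omega^{-1}=\mathsf{Code}^L(A)\text{ for some }A\in SL_2^+(\mathbb{Z})\}$, a subgroup of $S_n$, and $S_X=\{\omega\in G_X\mid\omega\,\mathsf{Code}^L(I)\,\omega^{-1}=\mathsf{Code}^L(I)\}$, a normal subgroup of $G_X$. *)

(* Defs.v *)
From HB Require Import structures.
From Stdlib Require Import Relation_Operators.
From mathcomp Require Import all_boot all_order all_algebra all_fingroup.
From mathcomp Require Import all_classical all_reals all_analysis.
Import Order.TTheory GRing.Theory Num.Theory.
Import numFieldNormedType.Exports.

Set Implicit Arguments.
Unset Strict Implicit.
Unset Printing Implicit Defensive.

Local Open Scope classical_set_scope.
Local Open Scope ring_scope.
Local Open Scope quotient_scope.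

Definition vec2 {R : nzRingType} (x y : R) : 'cV[R]_2 :=
  \col_k (if k == 0 then x else y).

Definition rot90 {R : nzRingType} (w : 'cV[R]_2) : 'cV[R]_2 :=
  vec2 (- w 1 0) (w 0 0).

Definition unit_square (R : realType) : set 'cV[R]_2 :=
  [set p | forall k, 0 <= p k 0 <= 1].
Arguments unit_square R : clear implicits.

Lemma unit_square0 (R : realType) : (0 : 'cV[R]_2) \in unit_square R.
Proof. by rewrite inE => k; rewrite mxE lexx ler01. Qed.

(* The disjoint union of the closed squares Q_i, with its sum topology. *)
Definition squares (R : realType) (n : nat) : topologicalType :=
  {i : 'I_n & unit_square R}.

(* [glued s t x y]: x is on the right (resp. top) side of Q_i and y is the
   translate of x on the left (resp. bottom) side of Q_(s i) (resp. Q_(t i));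
   since both points lie in the unit square, the equation forces x and y to be
   on these sides. *)
Definition glued (R : realType) (n : nat) (s t : 'S_n) (x y : squares R n) :
    Prop :=
  (projT1 y = s (projT1 x) /\ val (projT2 x) = val (projT2 y) + vec2 1 0) \/
  (projT1 y = t (projT1 x) /\ val (projT2 x) = val (projT2 y) + vec2 0 1).

Definition same_point (R : realType) (n : nat) (s t : 'S_n) :
    rel (squares R n) :=
  fun x y => `[< clos_refl_sym_trans _ (glued s t) x y >].

Lemma same_point_refl (R : realType) (n : nat) (s t : 'S_n) :
  reflexive (@same_point R n s t).
Proof. by move=> x; apply/asboolP; exact: rst_refl. Qed.

Lemma same_point_sym (R : realType) (n : nat) (s t : 'S_n) :
  symmetric (@same_point R n s t).
Proof. by move=> x y; apply/asboolP/asboolP => h; exact: rst_sym. Qed.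

Lemma same_point_trans (R : realType) (n : nat) (s t : 'S_n) :
  transitive (@same_point R n s t).
Proof.
by move=> y x z /asboolP xy /asboolP yz; apply/asboolP; exact: rst_trans xy yz.
Qed.

Canonical same_point_equiv (R : realType) (n : nat) (s t : 'S_n) :=
  EquivRel (@same_point R n s t) (@same_point_refl R n s t)
    (@same_point_sym R n s t) (@same_point_trans R n s t).

(* X(s, t), with the quotient topology. *)
Definition surface (R : realType) (n : nat) (s t : 'S_n) : topologicalType :=
  quotient_topology {eq_quot (same_point_equiv R s t)}.

Section Surface.
Context {R : realType} {n : nat} {s t : 'S_n}.
Local Notation V := 'cV[R]_2.
Local Notation X := (surface R s t).

(* The point of X with coordinates p in Q_i; only meaningful for p in the unit
   square (other p are sent to the south-west corner). *)
Definition pt (i : 'I_n) (p : V) : X :=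
  \pi_(quotient_topology {eq_quot (same_point_equiv R s t)})
    (existT (fun=> unit_square R : Type) i
       (insubd (exist _ 0 (unit_square0 R) : unit_square R) p)).

Definition corner (c : bool * bool) : V := vec2 (c.1%:R) (c.2%:R).

(* Every corner of a square glued to x contributes a right angle. For a point
   which is not a marked point the value is 0. *)
Definition cone_angle (x : X) : R :=
  (pi / 2) *+ #|[pred c : 'I_n * (bool * bool) | pt c.1 (corner c.2) == x]|.

(* The zeros of the 1-form induced by dz. *)
Definition zeros : set X := [set x | 2 * pi < cone_angle x].

(* The charts of the translation structure of X minus the zeros:
   homeomorphisms from an open set U onto an open set of the plane which, in
   the coordinates of each square, are locally translations. *)
Definition translation_chart (U : set X) (phi : X -> V) : Prop :=
  [/\ open U /\ U `&` zeros = set0,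
      set_inj U phi,
      forall x, U x -> {for x, continuous phi},
      forall W : set X, open W -> W `<=` U -> open (phi @` W)
    & forall (i : 'I_n) (p : V), unit_square R p -> U (pt i p) ->
        \forall q \near p, unit_square R q ->
          phi (pt i q) - phi (pt i p) = q - p].

(* h : D -> X is a local translation. When D is contained in a line this says
   that h is a straight path, parametrised by its developing map. *)
Definition translation_map (D : set V) (h : V -> X) : Prop :=
  forall z, D z -> exists U phi,
    [/\ translation_chart U phi, U (h z)
      & \forall z' \near z, D z' ->
          U (h z') /\ phi (h z') - phi (h z) = z' - z].

(* A rational number p/q is encoded by the integer vector v = (q, p), with
   q, p >= 0 coprime. *)
Definition dir (v : 'cV[int]_2) : V := map_mx intr v.

(* [saddle v i g]: the segment gamma_i of displacement v = (q, p) is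
   u |-> g (u *: dir v), u in [0, 1]. *)
Definition saddle (v : 'cV[int]_2) (i : 'I_n) (g : V -> X) : Prop :=
  [/\ {within [set u *: dir v | u in `[0, 1]], continuous g},
      translation_map [set u *: dir v | u in `]0, 1[] g
    & exists2 e : R, 0 < e &
        forall u : R, 0 <= u < e -> g (u *: dir v) = pt i (u *: dir v)].

Definition saddle_union (v : 'cV[int]_2) : set X :=
  [set x | exists i g (u : R), [/\ saddle v i g, 0 <= u <= 1 & x = g (u *: dir v)]].

Definition cylinder (v : 'cV[int]_2) (C : set X) : Prop :=
  exists2 x, ~ saddle_union v x & C = connected_component (~` saddle_union v) x.

(* The point reached from the origin by going along u *: dir v and then
   turning left by a right angle. *)
Definition leftpt (v : 'cV[int]_2) (u w : R) : V :=
  u *: dir v + w *: rot90 (dir v).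

(* C lies on the left of gamma_i: a one-sided collar of gamma_i. *)
Definition left_boundary (v : 'cV[int]_2) (C : set X) (i : 'I_n) : Prop :=
  exists (g h : V -> X) (e : R),
  [/\ saddle v i g, 0 < e,
      translation_map
        [set z | exists u w : R, [/\ 0 < u < 1, 0 <= w < e & z = leftpt v u w]] h,
      forall u : R, 0 < u < 1 -> h (u *: dir v) = g (u *: dir v)
    & forall u w : R, 0 < u < 1 -> 0 < w < e -> C (h (leftpt v u w))].

(* Walking along the boundary of C, with C on the left, gamma_i is followed by
   gamma_k: a strip of C extends continuously to its lower side, which is the
   concatenation of gamma_i and gamma_k. *)
Definition next_left_boundary (v : 'cV[int]_2) (C : set X) (i k : 'I_n) :
    Prop :=
  exists (gi gk h : V -> X) (e : R),
  [/\ saddle v i gi, saddle v k gk & 0 < e] /\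
  [/\ {within [set z | exists u w : R,
                 [/\ 0 <= u <= 2, 0 <= w < e & z = leftpt v u w]],
         continuous h},
      translation_map
        [set z | exists u w : R, [/\ 0 < u < 2, 0 < w < e & z = leftpt v u w]] h,
      forall u w : R, 0 < u < 2 -> 0 < w < e -> C (h (leftpt v u w)),
      forall u : R, 0 <= u <= 1 -> h (u *: dir v) = gi (u *: dir v)
    & forall u : R, 0 <= u <= 1 -> h ((1 + u) *: dir v) = gk (u *: dir v)].

Definition is_codeL (v : 'cV[int]_2) (c : 'S_n) : Prop :=
  forall i, exists C : set X,
    [/\ cylinder v C, left_boundary v C i & next_left_boundary v C i (c i)].

(* f is an affine diffeomorphism of derivative A, computed in translation
   charts at x and f x. Since A has determinant 1, f preserves the orientation
   and the inverse of f is also differentiable outside the zeros. *)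
Definition affine_diffeo (f : X -> X) (A : 'M[int]_2) : Prop :=
  [/\ \det A = 1,
      continuous f /\
        (exists f', [/\ continuous f', cancel f f' & cancel f' f]),
      f @` zeros = zeros
    & forall x, ~ zeros x -> exists U phi U' phi' h,
        [/\ translation_chart U phi /\ U x,
            translation_chart U' phi' /\ U' (f x),
            \forall y \near x, phi' (f y) = h (phi y)
          & is_diff (phi x) (h : V -> V) (mulmx (map_mx intr A))]].

End Surface.

(* The permutation Code^L(p/q), for v = (q, p). It is the only permutation
   satisfying is_codeL when q, p >= 0 are coprime, the default value 1 being
   irrelevant. *)
Definition codeL (R : realType) (n : nat) (s t : 'S_n) (v : 'cV[int]_2) :
    'S_n :=
  xget 1%g [set c | @is_codeL R n s t v c].

Definition SL2plus : set 'M[int]_2 :=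
  [set A | \det A = 1 /\ forall i j, 0 <= A i j].

(* For A = [a c; b d], the columns (a, b) and (c, d) encode b/a and d/c. *)
Definition codeLM (R : realType) (n : nat) (s t : 'S_n) (A : 'M[int]_2) :
    'S_n * 'S_n :=
  (codeL R s t (col 0 A), codeL R s t (col 1 A)).

Definition Veech (R : realType) (n : nat) (s t : 'S_n) : set 'M[int]_2 :=
  [set A | exists f, @affine_diffeo R n s t f A].

Definition Veech_plus (R : realType) (n : nat) (s t : 'S_n) : set 'M[int]_2 :=
  Veech R s t `&` SL2plus.

Local Open Scope group_scope.

(* The product of 'S_n is the left to right composition. *)
Definition conj_pair (n : nat) (a : 'S_n) (w : 'S_n * 'S_n) : 'S_n * 'S_n :=
  (a * w.1 * a^-1, a * w.2 * a^-1).

Definition GX (R : realType) (n : nat) (s t : 'S_n) : {set 'S_n} :=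
  finset (fun w => `[< exists2 A, SL2plus A &
    conj_pair w (codeLM R s t 1%:M) = codeLM R s t A >]).

Definition SX (R : realType) (n : nat) (s t : 'S_n) : {set 'S_n} :=
  finset (fun w => (w \in GX R s t) &&
    (conj_pair w (codeLM R s t 1%:M) == codeLM R s t 1%:M)).

Definition code_Veech_plus (R : realType) (n : nat) (s t : 'S_n) :
    {set 'S_n * 'S_n} :=
  finset (fun c => `[< exists2 A, Veech_plus R s t A & c = codeLM R s t A >]).

Definition is_group (T : Type) (op : T -> T -> T) : Prop :=
  associative op /\
  exists e inv, [/\ left_id e op, right_id e op,
                    left_inverse e inv op & right_inverse e inv op].

(* Main.v *)
(** Every matrix A of SL_2^+(Z) is a product of the elementary matrices
    U = [1 1; 0 1] and U^T, and each of these is the derivative of a homeomorphism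
    X(s', t') -> X(s, t) which shears the rows (resp. columns) of squares and
    keeps the label of the sector at each south-west corner. Hence X(s, t) is
    tiled by parallelograms spanned by the columns of A, glued along some (s', t'),
    and Code^L(A) = (s', s'^-1 t' s'). On codes, U and U^T act by the Nielsen moves
    (a, b) |-> (a, ab) and (a, b) |-> (ab, b), which commute with conjugation:
    Code^L(A) = u Code^L(I) u^-1 implies Code^L(AB) = u Code^L(B) u^-1, and the
    group statements follow.

    It remains to see that A is in the Veech group iff Code^L(A) is conjugate to
    Code^L(I). If it is, compose the tiling map with a relabelling of the squares.
    Conversely an affine diffeomorphism of derivative A gives a translation
    X(s, t) -> X(s', t'). It may move the marked points of angle 2 pi, but on each
    connected component it displaces points by a constant c modulo Z^2, and sending
    Q_i to the square containing the image of the point (1 - c)/2 of Q_i conjugates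
    (s, t) to (s', t'). *)

Require Import Defs.
From Stdlib Require Import Relation_Operators.
From mathcomp Require Import all_boot all_order all_algebra all_fingroup.
From mathcomp Require Import all_classical all_reals all_analysis.
From mathcomp Require Import ring lra zify.
Import Order.TTheory GRing.Theory Num.Theory.
Import numFieldNormedType.Exports.

Set Implicit Arguments.
Unset Strict Implicit.
Unset Printing Implicit Defensive.

Local Open Scope classical_set_scope.
Local Open Scope ring_scope.
Local Open Scope quotient_scope.

(** * Points of the surface and small displacements *)

(** Charts do not exist at the zeros, yet shears, strips and tilings have to be followed through
    them. The proof therefore replaces charts by the relation [step x d y], which makes sense
    everywhere: at a zero a short displacement may have several end points, at a regular point
    exactly one, and in both cases the end point determines the origin. Two rigidity facts then do
    most of the work: the image of a point in the torus, known modulo integer vectors, follows every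
    displacement, and two developments over a convex set that agree at one point agree everywhere.
    Both the uniqueness of the code and the rigidity of translations rest on them. *)

Lemma ord2_ind (P : 'I_2 -> Prop) : P 0 -> P 1 -> forall k, P k.
Proof.
move=> P0 P1 [[|[|k]] hk] //; [rewrite (_ : Ordinal hk = 0)//|
  rewrite (_ : Ordinal hk = 1)//]; exact: val_inj.
Qed.

Lemma vec2_eq (T : Type) (p q : 'cV[T]_2) :
  p 0 0 = q 0 0 -> p 1 0 = q 1 0 -> p = q.
Proof. by move=> h0 h1; apply/colP; exact: ord2_ind. Qed.

Section Points.
Context {R : realType} {n : nat} {s t : 'S_n}.
Local Notation V := 'cV[R]_2.
Local Notation X := (surface R s t).
Local Notation Q := (quotient_topology {eq_quot (same_point_equiv R s t)}).
Local Notation usq := (unit_square R).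

Definition side (k : 'I_2) : V := delta_mx k 0.
Definition side_perm (k : 'I_2) : 'S_n := if k == 0 then s else t.

Lemma sideE k l : side k l 0 = (l == k)%:R.
Proof. by rewrite mxE eqxx andbT. Qed.

Lemma side0E : side 0 = vec2 1 0.
Proof. by apply: vec2_eq; rewrite sideE mxE. Qed.

Lemma side1E : side 1 = vec2 0 1.
Proof. by apply: vec2_eq; rewrite sideE mxE. Qed.

Definition cls (i : 'I_n) (p : V) (hp : p \in usq) : squares R n :=
  existT (fun=> usq : Type) i (exist _ p hp).

Lemma pt_cls (i : 'I_n) (p : V) (hp : p \in usq) :
  pt i p = \pi_Q (cls i hp) :> X.
Proof.
rewrite /pt /cls; congr (\pi_Q (existT _ i _)).
by apply: val_inj; rewrite val_insubd hp.
Qed.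

Lemma pt_surj (x : X) : exists i p, usq p /\ x = pt i p.
Proof.
case E : (generic_quotient.repr (x : Q)) => [i [p hp]].
exists i, p; split; first by have := hp; rewrite inE.
by rewrite pt_cls -[x](@reprK _ Q) E.
Qed.

Lemma cls_eq (a b : squares R n) :
  (\pi_Q a = \pi_Q b) <-> clos_refl_sym_trans _ (glued s t) a b.
Proof.
split=> [/(@eqmodP _ (same_point_equiv R s t))/asboolP //|h].
by apply/(@eqmodP _ (same_point_equiv R s t))/asboolP.
Qed.

Lemma gluedP (a b : squares R n) : glued s t a b <->
  exists k, projT1 b = side_perm k (projT1 a) /\
            val (projT2 b) = val (projT2 a) - side k.
Proof.
split=> [[[h1 h2]|[h1 h2]]|].
- by exists 0; rewrite h2 side0E addrK.
- by exists 1; rewrite h2 side1E addrK.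
- move=> [k]; move: k; apply: ord2_ind => -[h1 h2]; [left|right]; split=> //.
  + by rewrite h2 side0E subrK.
  + by rewrite h2 side1E subrK.
Qed.

Lemma pt_glue k (i : 'I_n) (p : V) : usq p -> usq (p - side k) ->
  pt (side_perm k i) (p - side k) = pt i p :> X.
Proof.
move=> hp hq; rewrite (pt_cls i (mem_set hp)) (pt_cls _ (mem_set hq)).
by apply/esym/cls_eq/rst_step/gluedP; exists k.
Qed.

(** The identification of points is the equivalence closure of single gluings, so invariance under
    one gluing is enough; its symmetric case is the reason for asking an equivalence. *)
Lemma pt_ind (P : 'I_n -> V -> Prop) :
  (forall k i p, usq p -> usq (p - side k) ->
     P i p <-> P (side_perm k i) (p - side k)) ->
  forall i p j q, usq p -> usq q -> pt i p = pt j q :> X -> P i p -> P j q.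
Proof.
move=> hP i p j q hp hq.
rewrite (pt_cls i (mem_set hp)) (pt_cls _ (mem_set hq)) => /cls_eq h.
suff : P (projT1 (cls i (mem_set hp))) (val (projT2 (cls i (mem_set hp)))) <->
       P (projT1 (cls j (mem_set hq))) (val (projT2 (cls j (mem_set hq)))).
  by move=> /= [].
elim: h => [a b /gluedP[k [h1 h2]]|//|a b _ [h1 h2]|a b c _ [h1 h2] _ [h3 h4]].
- rewrite h1 h2; apply: hP.
    by case: a {h1 h2} => i' [p' hp'] /=; rewrite inE in hp'.
  by case: b h1 h2 => j' [q' hq'] /= _ <-; rewrite inE in hq'.
- by split.
- by split=> ?; auto.
Qed.

(* d is shorter than 1/2 and than the distance from p to the sides of the square
   which do not contain p. The condition is compatible with the gluing. *)
Definition good (p d : V) : Prop := forall k,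
  [/\ `|d k 0| < 2^-1, p k 0 != 0 -> `|d k 0| < p k 0
    & p k 0 != 1 -> `|d k 0| < 1 - p k 0].

(* Whatever square the end point of a small displacement is seen from, the
   displacement can be undone inside that square. *)
Lemma pt_back i p d j w : usq p -> good p d -> usq (p + d) -> usq w ->
  pt i (p + d) = pt j w :> X -> usq (w - d) /\ pt j (w - d) = pt i p :> X.
Proof.
move=> hp hg hpd hw e.
pose P j w := [/\ good (w - d) d, usq (w - d) & pt j (w - d) = pt i p :> X].
suff : P j w by case.
apply: (pt_ind _ hpd hw e); last by split; rewrite addrK.
move=> k {e hw}j {hpd}w hw hwk.
have eqd : w - side k - d = w - d - side k by rewrite addrAC.
have hk := hw k; have := hwk k; rewrite !mxE !eqxx => hk'.
have wk1 : w k 0 = 1 by move: hk hk' => /=; lra.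
have oth l : l != k -> (w - side k - d) l 0 = (w - d) l 0.
  by move=> lk; rewrite !mxE (negbTE lk) /=; lra.
split=> -[hg1 hg2 hg3].
(* A good displacement that ends on a side runs along it: otherwise its origin [w - d] would be off
   that side, at a distance equal to the component of [d], against [good]. *)
- have dk0 : d k 0 = 0.
    have [_ _] := hg1 k; have := hg2 k; rewrite !mxE wk1 => hh.
    case: (ltrgtP (d k 0) 0) => // hd H; first lra.
    have /H : 1 - d k 0 != 1 by apply/eqP; lra.
    by rewrite gtr0_norm//; lra.
  have hk0 : (w - side k - d) k 0 = 0 by rewrite !mxE !eqxx wk1 dk0 /=; lra.
  have h : usq (w - side k - d).
    by move=> l; have [->|lk] := eqVneq l k; [rewrite hk0; lra|rewrite oth].
  split=> //; last by rewrite -hg3 eqd pt_glue -?eqd.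
  move=> l; have [->|lk] := eqVneq l k; last by rewrite oth.
  by rewrite hk0 eqxx dk0 normr0; split=> // _; lra.
- have dk0 : d k 0 = 0.
    have [_ + _] := hg1 k; have := hg2 k; rewrite !mxE wk1 !eqxx /= => hh.
    case: (ltrgtP (d k 0) 0) => // hd H; last lra.
    have /H : 1 - 1 - d k 0 != 0 by apply/eqP; lra.
    by rewrite ltr0_norm//; lra.
  have hk1 : (w - d) k 0 = 1 by rewrite !mxE wk1 dk0; lra.
  have h : usq (w - d).
    by move=> l; have [->|lk] := eqVneq l k; [rewrite hk1; lra|rewrite -oth].
  split=> //; last by rewrite -hg3 eqd pt_glue// -eqd.
  move=> l; have [->|lk] := eqVneq l k; last by rewrite -oth.
  by rewrite hk1 eqxx dk0 normr0; split=> // _; lra.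
Qed.

Definition intv (c : V) : Prop := forall k, c k 0 \is a Num.int.

Lemma intv0 : intv 0.
Proof. by move=> k; rewrite mxE. Qed.

Lemma intvD c c' : intv c -> intv c' -> intv (c + c').
Proof. by move=> h h' k; rewrite mxE rpredD. Qed.

Lemma intvN c : intv c -> intv (- c).
Proof. by move=> h k; rewrite mxE rpredN. Qed.

Lemma intv_side k : intv (side k).
Proof. by move=> l; rewrite sideE natr_int. Qed.

Lemma intv_small c : intv c -> (forall k, `|c k 0| < 1) -> c = 0.
Proof.
move=> hc hs; apply/colP => k; rewrite mxE.
have := hc k; have := hs k => /[swap] /intrP[m ->].
by rewrite -intr_norm -[1]/(1%:~R) ltr_int => ?; rewrite (_ : m = 0)//; lia.
Qed.

Lemma pt_intv i p j q : usq p -> usq q -> pt i p = pt j q :> X -> intv (q - p).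
Proof.
move=> hp hq e; apply: (pt_ind (P := fun _ q => intv (q - p)) _ hp hq e).
  move=> k _ w _ _; rewrite addrAC; split=> h.
    by apply: intvD => //; apply/intvN/intv_side.
  by rewrite -[w - p](subrK (side k)); apply: intvD => //; exact: intv_side.
by rewrite subrr; exact: intv0.
Qed.

Lemma subside_neq (p : V) k l : l != k -> (p - side k) l 0 = p l 0.
Proof. by move=> lk; rewrite !mxE (negbTE lk) /=; lra. Qed.

Lemma usq_subside p k : usq p -> p k 0 = 1 -> usq (p - side k).
Proof.
move=> hp pk l; have [->|lk] := eqVneq l k; last by rewrite subside_neq.
by rewrite !mxE pk !eqxx /=; lra.
Qed.

Lemma usq_addside p k : usq p -> p k 0 = 0 -> usq (p + side k).
Proof.
move=> hp pk l; have [->|lk] := eqVneq l k; rewrite !mxE.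
  by rewrite pk !eqxx /=; lra.
by rewrite (negbTE lk) addr0.
Qed.

Lemma pt_glueV k i p : usq p -> p k 0 = 0 ->
  pt ((side_perm k)^-1%g i) (p + side k) = pt i p :> X.
Proof.
move=> hp pk; have h := usq_addside hp pk.
by rewrite -(pt_glue (k := k) _ h) addrK// permKV.
Qed.

(* The germ of this relation at x determines the neighbourhoods of x, the charts,
   and the local translations; y is unique only if x is not a zero. *)
Definition step (x : X) (d : V) (y : X) : Prop := exists i p,
  [/\ unit_square R p, unit_square R (p + d), x = pt i p & y = pt i (p + d)].

(* Equivalent to not being a zero, see [zerosE]. *)
Definition regular (x : X) : Prop := forall i j p,
  unit_square R p -> x = pt i p -> x = pt j p -> i = j.

Definition near_point (x : X) (d : V) : Prop := forall i p,
  unit_square R p -> x = pt i p -> good p d.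

(** A gluing turns a coordinate 1 into 0, and at both values the three conditions reduce to the
    bound [2^-1]; the other coordinate does not change. *)
Lemma good_pt i p j q d : usq p -> usq q -> pt i p = pt j q :> X ->
  good p d -> good q d.
Proof.
move=> hp hq e; apply: (pt_ind (P := fun _ q => good q d) _ hp hq e).
move=> k _ w hw hwk.
have := hw k; have := hwk k; rewrite !mxE !eqxx /= => h1 h2.
have wk1 : w k 0 = 1 by lra.
have wk0 : (w - side k) k 0 = 0 by rewrite !mxE !eqxx wk1 /=; lra.
have oth l : l != k -> (w - side k) l 0 = w l 0.
  by move=> lk; rewrite !mxE (negbTE lk) /=; lra.
split=> hg l; have := hg l; (have [->|lk] := eqVneq l k; last by rewrite oth).
  by rewrite wk0 wk1 !eqxx => -[h _ _]; split=> // _; lra.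
by rewrite wk0 wk1 !eqxx => -[h _ _]; split=> // _; lra.
Qed.

Lemma step_back x d k w : near_point x d -> usq w -> step x d (pt k w) ->
  usq (w - d) /\ pt k (w - d) = x.
Proof.
move=> hx hw [i [p [hp hpd ex e]]]; rewrite ex.
by apply: pt_back hpd hw (esym e) => //; exact: hx ex.
Qed.

Lemma step_inj_src x y d w : near_point x d -> step x d w -> step y d w -> x = y.
Proof.
move=> hx hxw [k [q [hq hqd -> ew]]]; move: hxw; rewrite ew => hxw.
by have [_ <-] := step_back hx hqd hxw; rewrite addrK.
Qed.

(** The two displacements differ by an integer vector, whose coordinates are below 1 thanks to the
    bound [2^-1] in [good]. *)
Lemma step_inj_disp x d d' y : near_point x d -> near_point x d' ->
  step x d y -> step x d' y -> d = d'.
Proof.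
move=> hd hd' h [k [q [hq hqd ex ey]]]; move: h; rewrite ey => h.
have [h1 h2] := step_back hd hqd h.
have := pt_intv hq h1 (etrans (esym ex) (esym h2)).
rewrite addrAC [q + _]addrC addrK => hi; apply/eqP; rewrite eq_sym -subr_eq0.
apply/eqP/intv_small => // l; rewrite !mxE.
have [a _ _] := hd _ _ hq ex l; have [b _ _] := hd' _ _ hq ex l.
by apply: le_lt_trans (ler_normB _ _) _; lra.
Qed.

(** The second displacement lies in one square; by [step_back] the first can be undone inside that
    same square. *)
Lemma step_trans x d y e z : near_point x d -> step x d y -> step y e z ->
  step x (d + e) z.
Proof.
move=> hx hxy [k [w [hw hwe ey ez]]]; move: hxy; rewrite ey => hxy.
have [h1 h2] := step_back hx hw hxy.
by exists k, (w - d); rewrite addrA subrK.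
Qed.

Lemma regular_step x d y : regular x -> near_point x d -> step x d y -> regular y.
Proof.
move=> rx hx hxy i j p hp ey ey'.
have [h1 h2] : usq (p - d) /\ pt i (p - d) = x by apply: step_back; rewrite -?ey.
have [_ h3] : usq (p - d) /\ pt j (p - d) = x by apply: step_back; rewrite -?ey'.
exact: rx h1 (esym h2) (esym h3).
Qed.

(** If [p k 0 = 1] and [0 <= d k 0], staying in the square forces [d k 0 = 0], so both ends can be
    rewritten in the neighbouring square. *)
Lemma step_rep x k d y : step x d y -> forall i p, usq p -> usq (p + d) ->
  x = pt i p -> y = pt i (p + d) -> exists i' p',
  [/\ [/\ unit_square R p', unit_square R (p' + d), x = pt i' p' & y = pt i' (p' + d)],
     forall l, l != k -> p' l 0 = p l 0
   & if d k 0 < 0 then p' k 0 != 0 else p' k 0 != 1].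
Proof.
move=> _ i p hp hpd ex ey.
have hk := hp k; have := hpd k; rewrite mxE => hk'.
have [hd|hd] := ltP (d k 0) 0.
  by exists i, p; split=> //; apply/eqP; lra.
have [p1|p1] := eqVneq (p k 0) 1; last by exists i, p.
have d0 : d k 0 = 0 by lra.
exists (side_perm k i), (p - side k).
have e : p - side k + d = p + d - side k by rewrite addrAC.
have pk0 : (p - side k) k 0 = 0 by rewrite !mxE p1 !eqxx /=; lra.
have h1 := usq_subside hp p1.
have h2 : usq (p - side k + d).
  move=> l; have [->|lk] := eqVneq l k; first by rewrite mxE pk0 d0; lra.
  by rewrite mxE subside_neq//; have := hpd l; rewrite mxE.
split=> [|l /subside_neq//|]; last by rewrite pk0; apply/eqP; lra.
by split=> //; [rewrite pt_glue|rewrite e pt_glue -?e].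
Qed.

(* Among the representatives of x, choose the one lying on the side that d leaves
   towards the interior; for a regular x it is determined by d. *)
Lemma step_norm x d y : step x d y -> exists i p,
  [/\ unit_square R p, unit_square R (p + d), x = pt i p, y = pt i (p + d)
    & forall k, if d k 0 < 0 then p k 0 != 0 else p k 0 != 1].
Proof.
move=> h; have [i [p [h1 h2 h3 h4]]] := h.
have [i' [p' [[h1' h2' h3' h4'] _ p0]]] := step_rep 0 h h1 h2 h3 h4.
have [i2 [p2 [[? ? ? ?] e p1]]] := step_rep 1 h h1' h2' h3' h4'.
by exists i2, p2; split=> //; apply: ord2_ind => //; rewrite e.
Qed.

(** After [step_norm], each coordinate of both representatives lies in the same half-open unit
    interval, chosen by the sign of [d]; as they differ by integers they coincide, and regularity
    identifies the squares. *)
Lemma step_unique x d y y' : regular x -> step x d y -> step x d y' -> y = y'.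
Proof.
move=> rx /step_norm[i [p [hp hpd ex -> np]]] /step_norm[j [q [hq hqd ex' -> nq]]].
have hi := pt_intv hp hq (etrans (esym ex) ex').
suff epq : q = p by rewrite epq in ex' *; rewrite (rx i j p).
apply/eqP; rewrite -subr_eq0; apply/eqP/intv_small => // k.
have := np k; have := nq k; have := hp k; have := hq k; rewrite !mxE.
by case: ifP => _ h1 h2 /eqP h3 /eqP h4; rewrite ltr_norml; lra.
Qed.

(** A short [d] can leave a square only through a side containing [x]; one then passes to the
    neighbour, one coordinate at a time. *)
Lemma step_exists x d : near_point x d -> exists y, step x d y.
Proof.
move=> hx.
have key k i p : usq p -> x = pt i p -> exists i' p',
    [/\ usq p', x = pt i' p', forall l, l != k -> p' l 0 = p l 0
      & 0 <= p' k 0 + d k 0 <= 1].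
  move=> hp ex; have [g1 g2 g3] := hx _ _ hp ex k; have hk := hp k.
  move: g1; rewrite ltr_norml => /andP[g1 g1'].
  have [p1|p1] := eqVneq (p k 0) 1.
    have [hd|hd] := ltP 0 (d k 0); last by exists i, p; split=> //; lra.
    exists (side_perm k i), (p - side k); split.
    - exact: usq_subside.
    - by rewrite pt_glue//; exact: usq_subside.
    - by move=> l /subside_neq ->.
    - by rewrite !mxE p1 !eqxx /=; lra.
  have [p0|p0] := eqVneq (p k 0) 0.
    have [hd|hd] := ltP (d k 0) 0; last by exists i, p; split=> //; lra.
    exists ((side_perm k)^-1%g i), (p + side k); split.
    - exact: usq_addside.
    - by rewrite pt_glueV.
    - by move=> l lk; rewrite !mxE (negbTE lk) addr0.
    - by rewrite !mxE p0 !eqxx /=; lra.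
  exists i, p; split=> //; move: (g2 p0) (g3 p1); rewrite !ltr_norml; lra.
have [i [p [hp ex]]] := pt_surj x.
have [i1 [p1 [hp1 ex1 _ h0]]] := key 0 _ _ hp ex.
have [i2 [p2 [hp2 ex2 e h1]]] := key 1 _ _ hp1 ex1.
exists (pt i2 (p2 + d)), i2, p2; split=> //.
by apply: ord2_ind; rewrite mxE// e.
Qed.

Lemma near_vecP (z : V) (P : V -> Prop) : (\forall d \near z, P d) <->
  exists2 r : R, 0 < r & forall d : V, (forall k, `|d k 0 - z k 0| < r) -> P d.
Proof.
split=> [/nbhs_ballP[r r0 h]|[r r0 h]].
  exists r => // d hd; apply: h; split=> // k l; rewrite (ord1 l) /ball/= distrC.
  exact: hd.
apply/nbhs_ballP; exists r => // d [_ hd]; apply: h => k.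
by have := hd k 0; rewrite /ball/= distrC.
Qed.

Lemma near_shiftP (z : V) (P : V -> Prop) :
  (\forall z' \near z, P z') <-> (\forall d \near (0 : V), P (z + d)).
Proof.
split=> /near_vecP[r r0 h]; apply/near_vecP; exists r => // d hd.
  apply: h => k; rewrite (_ : _ - _ = d k 0 - (0 : V) k 0)//.
  by rewrite !mxE; ring.
rewrite -(subrK z d) addrC; apply: h => k.
by rewrite (_ : _ - _ = d k 0 - z k 0)// !mxE; ring.
Qed.

Lemma near_good p : usq p -> \forall d \near (0 : V), good p d.
Proof.
move=> hp; apply/near_vecP.
have key k : exists2 r : R, 0 < r & forall a : R, `|a| < r -> [/\ `|a| < 2^-1,
    p k 0 != 0 -> `|a| < p k 0 & p k 0 != 1 -> `|a| < 1 - p k 0].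
  exists (Num.min 2^-1 (Num.min (if p k 0 == 0 then 1 else p k 0)
                                (if p k 0 == 1 then 1 else 1 - p k 0))).
    have := hp k; rewrite !lt_min; case: eqP => ?; case: eqP => ? ?; lra.
  by move=> a; rewrite !lt_min => /and3P[]; case: eqP; case: eqP.
have [r r0 h] := key 0; have [r' r'0 h'] := key 1.
exists (Num.min r r'); first by rewrite lt_min r0.
move=> d hd; apply: ord2_ind; [apply: h|apply: h'].
  by have := hd 0; rewrite mxE subr0 lt_min => /andP[].
by have := hd 1; rewrite mxE subr0 lt_min => /andP[].
Qed.

Lemma near_near_point x : \forall d \near (0 : V), near_point x d.
Proof.
have [i [p [hp ex]]] := pt_surj x.
apply: filterS (near_good hp) => d hd j q hq ex'.
exact: (good_pt hp hq (etrans (esym ex) ex') hd).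
Qed.

Lemma step0 x : step x 0 x.
Proof.
by have [i [p [hp ex]]] := pt_surj x; exists i, p; split; rewrite ?addr0.
Qed.

Lemma step0E x y : step x 0 y -> y = x.
Proof. by move=> [i [p [_ _ -> ->]]]; rewrite addr0. Qed.

(** A converse of [step_trans]: going through [y0] produces an end point of [d0 + e], and at a
    regular [x] there is only one. *)
Lemma step_near_assoc x d0 y0 : regular x -> near_point x d0 -> step x d0 y0 ->
  \forall e \near (0 : V), forall z, step x (d0 + e) z -> step y0 e z.
Proof.
move=> rx hx h; apply: filterS (near_near_point y0) => e he z hz.
have [z' hz'] := step_exists he; rewrite (step_unique rx hz (y' := z'))//.
exact: step_trans hz'.
Qed.

Lemma pt_surj2 (x : X) : exists2 p, usq p & exists i, x = pt i p.
Proof. by have [i [p [hp ex]]] := pt_surj x; exists p => //; exists i. Qed.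

(** A lift to the plane of the image of [x] in the unit torus. It comes from a choice, hence is
    meaningful only modulo [intv]. *)
Definition tor (x : X) : V := sval (cid2 (pt_surj2 x)).

Lemma tor_pt (x : X) i p : usq p -> x = pt i p -> intv (tor x - p).
Proof.
rewrite /tor; case: cid2 => q /= hq [j ->] hp e.
exact: pt_intv (esym e).
Qed.

Lemma tor_step x d y : step x d y -> intv (tor y - tor x - d).
Proof.
move=> [i [p [hp hpd ex ey]]].
rewrite (_ : _ - d = (tor y - (p + d)) - (tor x - p)).
  by apply: intvD; [exact: tor_pt ey|apply: intvN; exact: tor_pt ex].
by apply/colP => k; rewrite !mxE; ring.
Qed.

End Points.

(** * Zeros *)

Section Zeros.
Context {R : realType} {n : nat} {s t : 'S_n}.
Local Notation V := 'cV[R]_2.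
Local Notation X := (surface R s t).
Local Notation usq := (unit_square R).

(** Only gluings in the other direction [l] apply to such a point, so it has at most two
    representatives; [c] sends both to the one whose coordinate [l] is not 1, and is thus constant
    on the class. *)
Lemma pt_inj_edge k i j (p : V) : usq p -> 0 < p k 0 < 1 ->
  pt i p = pt j p :> X -> i = j.
Proof.
move=> hp pk e.
have [l lk] : exists l : 'I_2, l != k by elim/ord2_ind: k pk => _; [exists 1|exists 0].
have kl m : m != k -> m = l.
  by move: m l k lk {pk}; do 3 (apply: ord2_ind => //).
pose c j (w : V) := if w l 0 == 1 then (@side_perm n s t l j, w - side l) else (j, w).
suff [_] : p k 0 = p k 0 /\ c j p = c i p.
  by rewrite /c; case: eqP => _ [] // /perm_inj.
apply: (pt_ind (P := fun j w => w k 0 = p k 0 /\ c j w = c i p) _ hp hp e) => //.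
move=> m {e}j w hw hw'.
have wm : w m 0 = 1 by have := hw' m; have := hw m; rewrite !mxE !eqxx /=; lra.
have e0 : (w - side m) m 0 = 0 by rewrite !mxE wm !eqxx subrr.
split=> -[wk <-].
  have ml : m = l.
    by apply: kl; apply/eqP => mk; move: pk; rewrite -wk -mk wm; lra.
  subst m; rewrite subside_neq 1?eq_sym// /c wm eqxx e0.
  by rewrite eq_sym oner_eq0.
have ml : m = l.
  by apply: kl; apply/eqP => mk; move: pk; rewrite -wk -mk e0; lra.
subst m; rewrite subside_neq 1?eq_sym// in wk.
by rewrite /c wm eqxx e0 eq_sym oner_eq0.
Qed.

Lemma cornerP (p : V) : usq p -> ~ (exists k, 0 < p k 0 < 1) ->
  exists c, p = corner c.
Proof.
move=> hp h; exists (p 0 0 == 1, p 1 0 == 1).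
have key k : p k 0 = (p k 0 == 1)%:R.
  case: eqP => p1 //=; have := hp k.
  have [p0 _|p0 hk] := eqVneq (p k 0) 0; first by rewrite p0.
  exfalso; apply: h; exists k; rewrite lt_neqAle eq_sym p0 lt_neqAle.
  by case/andP: hk => -> ->; rewrite !andbT; apply/eqP.
by apply: vec2_eq; rewrite [LHS]key mxE.
Qed.

Lemma corner_sq c : usq (corner c).
Proof.
by apply: ord2_ind; rewrite mxE /=; case: c => -[] [] /=; lra.
Qed.

Lemma corner_toggle (x : X) a b : (exists i, x = pt i (corner (a, b))) ->
  (exists i, x = pt i (corner (~~ a, b))) /\
  (exists i, x = pt i (corner (a, ~~ b))).
Proof.
have hc := corner_sq (a, b); move=> [i ->]; split.
- case: a hc => hc.
    have e : corner (false, b) = corner (true, b) - side 0 :> V.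
      by apply: vec2_eq; rewrite !mxE /=; ring.
    exists (@side_perm n s t 0 i); rewrite /= e pt_glue// -e; exact: corner_sq.
  exists ((@side_perm n s t 0)^-1%g i).
  rewrite -(pt_glueV (k := 0) i hc) ?mxE//; congr pt.
  by apply: vec2_eq; rewrite !mxE /=; ring.
- case: b hc => hc.
    have e : corner (a, false) = corner (a, true) - side 1 :> V.
      by apply: vec2_eq; rewrite !mxE /=; ring.
    exists (@side_perm n s t 1 i); rewrite /= e pt_glue// -e; exact: corner_sq.
  exists ((@side_perm n s t 1%R)^-1%g i).
  rewrite -(pt_glueV (k := 1) i hc) ?mxE//; congr pt.
  by apply: vec2_eq; rewrite !mxE /=; ring.
Qed.

Lemma corner_all (x : X) c0 : (exists i, x = pt i (corner c0)) ->
  forall c, exists i, x = pt i (corner c).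
Proof.
case: c0 => a b h; have [h1 h2] := corner_toggle h.
have [_ h3] := corner_toggle h1.
by case: a h h1 h2 h3 => h h1 h2 h3; case: b h h1 h2 h3 => h h1 h2 h3 -[[] []].
Qed.

(** The cone angle exceeds [2 * pi] iff more than four square corners meet at [x]. At a regular
    point each of the four types of corner occurs at most once. A point that is not regular is a
    corner by [pt_inj_edge]; all four types occur there and one occurs twice, which gives the five
    elements of [D]. *)
Lemma zerosE (x : X) : zeros x <-> ~ regular x.
Proof.
rewrite /zeros /cone_angle /=.
set A := [pred c : 'I_n * (bool * bool) | _].
have -> : (2 * pi < (pi / 2) *+ #|A| :> R) = (4 < #|A|)%N.
  rewrite -[_ / _ *+ _]mulr_natr -(ltr_nat R) (_ : 2 * pi = 4 * (pi / 2) :> R); last by field.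
  by rewrite [X in _ < X]mulrC ltr_pM2r// divr_gt0// pi_gt0.
split=> [A4 rx|].
  move: A4; rewrite ltnNge => /negP; apply.
  rewrite -cardsE -(@card_in_imset _ _ snd).
    by apply: leq_trans (max_card _) _; rewrite card_prod card_bool.
  move=> [i c] [j c']; rewrite !inE /= => /eqP ei /eqP ej ec.
  by rewrite -ec in ej *; rewrite (rx i j (corner c))//; exact: corner_sq.
move=> /existsNP[i /existsNP[j /existsNP[p /not_implyP[hp]]]].
move=> /not_implyP[ei /not_implyP[ej ij]].
have [c0 ec] : exists c, p = corner c.
  apply: cornerP => // -[k hk]; apply: ij.
  by apply: (pt_inj_edge hp hk); rewrite -ei.
have /choice[f hf] : forall c, exists i, x = pt i (corner c).
  by apply: (@corner_all _ c0); exists i; rewrite -ec.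
have [i1 [e1 ne1]] : exists i1, x = pt i1 (corner c0) /\ i1 != f c0.
  rewrite -ec; have [e|ne] := eqVneq i (f c0); last by exists i.
  by exists j; split=> //; rewrite -e; apply/eqP => e'; apply: ij.
pose D := ((i1, c0) |: [set (f c, c) | c : bool * bool])%SET.
have D5 : #|D| = 5%N.
  rewrite cardsU1 card_imset; last by move=> c c' [].
  rewrite card_prod card_bool; case: imsetP => //= -[c _ [e ec']].
  by move: ne1; rewrite e ec' eqxx.
rewrite -D5; apply: subset_leq_card; apply/fintype.subsetP => -[i' c].
rewrite !inE => /orP[/eqP[-> ->]|/imsetP[c' _ [-> ->]]] /=.
  by rewrite -e1.
by rewrite -hf.
Qed.

End Zeros.

(** * Neighbourhoods and charts *)

Section Topology.
Context {R : realType} {n : nat} {s t : 'S_n}.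
Local Notation V := 'cV[R]_2.
Local Notation X := (surface R s t).
Local Notation Q := (quotient_topology {eq_quot (same_point_equiv R s t)}).
Local Notation usq := (unit_square R).

Lemma open_ptP (O : set X) : open O <-> forall i p, unit_square R p ->
  O (pt i p) -> \forall q \near p, unit_square R q -> O (pt i q).
Proof.
have eO i (a : usq) : O (pt i (val a)) =
    ((fun a => existT (fun=> usq : Type) i a) @^-1` (\pi_Q @^-1` O)) a.
  by case: a => p hp /=; rewrite pt_cls.
split=> [oO i p hp Op|h].
  have /sigT_openP/(_ i)[A oA eA] : open (\pi_Q @^-1` O) := oO.
  have hA (q : V) (hq : q \in usq) : A q <-> O (pt i q).
    by rewrite (eO i (exist _ q hq)) -eA.
  have : nbhs p A by apply: open_nbhs_nbhs; split=> //; apply/(hA p (mem_set hp)).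
  by apply: filterS => q Aq hq; apply/(hA q (mem_set hq)).
change (open (\pi_Q @^-1` O)); apply/sigT_openP => i.
exists (interior [set q | usq q -> O (pt i q)]); first exact: open_interior.
apply/seteqP; split=> a; rewrite -eO /=.
  by move=> /interior_subset; apply; exact: set_valP.
by move=> Oa; apply: h => //; exact: set_valP.
Qed.

(** Finiteness of the representatives is what allows [near_rep] to intersect the neighbourhoods
    found at each of them. The shift by 1 makes ['I_3] encode the integers -1, 0, 1. *)
Lemma rep_finite (x : X) i p : usq p -> x = pt i p -> exists m : 'I_3 * 'I_3,
  p = tor x + vec2 (m.1%:R - 1) (m.2%:R - 1).
Proof.
move=> hp ex.
have [q hq [j ex']] := pt_surj2 x.
have ht : usq (tor x) by rewrite /tor; case: cid2.
have key k : exists m : 'I_3, p k 0 = tor x k 0 + (m%:R - 1).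
  have := tor_pt hp ex k; rewrite !mxE => /intrP[z ez].
  have h1 := hp k; have h2 := ht k.
  have [z1 z2] : -1 <= z /\ z <= 1.
    by split; rewrite -(ler_int R) -ez ?mulrN1z; lra.
  have zE : (`|1 - z|%N < 3)%N by lia.
  exists (Ordinal zE) => /=; rewrite natr_absz ger0_norm; last lia.
  by rewrite rmorphB /= -ez; ring.
have [m0 e0] := key 0; have [m1 e1] := key 1.
by exists (m0, m1); apply: vec2_eq; rewrite mxE [in RHS]mxE /= ?e0 ?e1.
Qed.

Lemma near_rep (x : X) (P : 'I_n -> V -> V -> Prop) :
  (forall i p, usq p -> x = pt i p -> \forall d \near (0 : V), P i p d) ->
  \forall d \near (0 : V), forall i p, usq p -> x = pt i p -> P i p d.
Proof.
move=> h; pose pp (m : 'I_3 * 'I_3) : V := tor x + vec2 (m.1%:R - 1) (m.2%:R - 1).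
have : \forall d \near (0 : V), forall a : 'I_n * ('I_3 * 'I_3),
    usq (pp a.2) -> x = pt a.1 (pp a.2) ->
    P a.1 (pp a.2) d.
  apply: (@filter_forall _ _ ( fun (a : 'I_n * ('I_3 * 'I_3)) d =>
    usq (pp a.2) -> x = pt a.1 (pp a.2) -> P a.1 (pp a.2) d) (nbhs (0 : V))) => -[i m] /=.
  have [hp|hp] := pselect (usq (pp m) /\ x = pt i (pp m)).
    by apply: filterS (h _ _ hp.1 hp.2) => d.
  by apply: nearW => d h1 h2; case: hp.
apply: filterS => d hd i p hp ex; have [m em] := rep_finite hp ex.
by have := hd (i, m); rewrite /= /pp -em; apply.
Qed.

Definition star (x : X) (r : R) : set X :=
  [set y | exists2 d : V, (forall k, `|d k 0| < r) & step x d y].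

Lemma near_box (d : V) (r : R) : (forall k, `|d k 0| < r) ->
  \forall e \near (0 : V), forall k, `|(d + e) k 0| < r.
Proof.
move=> hd; apply/near_vecP; exists (Num.min (r - `|d 0 0|) (r - `|d 1 0|)).
  by rewrite lt_min !subr_gt0 !hd.
move=> e he k; rewrite mxE; apply: le_lt_trans (ler_normD _ _) _.
have := he k; rewrite mxE subr0 lt_min => /andP[].
by move: k {he}; apply: ord2_ind; lra.
Qed.

Lemma star_open (x : X) (r : R) :
  (forall d : V, (forall k, `|d k 0| < r) -> near_point x d) -> open (star x r).
Proof.
move=> hr; apply/open_ptP => i w hw [d hd hxw].
apply/(near_shiftP w (fun q => usq q -> star x r (pt i q))).
apply: filterS (near_box hd) => e he hwe; exists (d + e) => //.
by apply: step_trans hxw _; [exact: hr|exists i, w].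
Qed.

Lemma near_point_radius (x : X) : exists2 r : R, 0 < r &
  forall d : V, (forall k, `|d k 0| < r) -> near_point x d.
Proof.
have /near_vecP[r r0 h] := near_near_point x; exists r => // d hd; apply: h => k.
by rewrite mxE subr0.
Qed.

(** Small stars are open by [star_open], so they form a basis of neighbourhoods, at zeros as well.
    Topological statements on the surface become statements about small vectors. *)
Lemma nbhs_step (x : X) (S : set X) : nbhs x S <->
  \forall d \near (0 : V), forall y, step x d y -> S y.
Proof.
split.
  rewrite nbhsE => -[W [/open_ptP oW Wx] WS].
  suff : \forall d \near (0 : V), forall i p, usq p -> x = pt i p ->
      usq (p + d) -> W (pt i (p + d)).
    by apply: filterS => d hd y [i [p [hp hpd ex ->]]]; apply: WS; exact: hd.
  apply: near_rep => i p hp ex; apply/(near_shiftP p (fun q => usq q -> W (pt i q))).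
  by apply: oW => //; rewrite -ex.
move=> hS.
have /near_vecP[r r0 h] : \forall d \near (0 : V),
    (forall y, step x d y -> S y) /\ near_point x d.
  by apply: filterI => //; exact: near_near_point.
have hr (d : V) : (forall k, `|d k 0| < r) ->
    (forall y, step x d y -> S y) /\ near_point x d.
  by move=> hd; apply: h => k; rewrite mxE subr0.
rewrite nbhsE; exists (star x r); last by move=> y [d /hr[hd _] /hd].
split; first by apply: star_open => d /hr[].
by exists 0; [move=> k; rewrite mxE normr0|exact: step0].
Qed.

Definition local_translation (D : set V) (h : V -> X) : Prop := forall z, D z ->
  regular (h z) /\ \forall z' \near z, D z' -> step (h z) (z' - z) (h z').

Lemma chart_step U phi (x : X) : translation_chart U phi -> U x ->
  \forall d \near (0 : V), forall y, step x d y -> U y /\ phi y = phi x + d.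
Proof.
move=> [[oU _] _ _ _ hphi] Ux.
have hU : \forall d \near (0 : V), forall y, step x d y -> U y.
  by apply/nbhs_step/open_nbhs_nbhs.
have : \forall d \near (0 : V), forall i p, usq p -> x = pt i p ->
    usq (p + d) -> phi (pt i (p + d)) = phi x + d.
  apply: near_rep => i p hp ex.
  have := hphi i p hp; rewrite -ex => /(_ Ux) /near_shiftP.
  apply: filterS => d h /h; rewrite addrAC subrr add0r.
  by move=> /eqP; rewrite subr_eq [d + _]addrC => /eqP.
apply: filterS2 hU => d hU hd y hy; split; first exact: hU.
by case: hy => i [p [hp hpd ex ->]]; exact: hd.
Qed.

Lemma chart_regular U phi (x : X) : translation_chart U phi -> U x -> regular x.
Proof.
move=> [[_ U0] _ _ _ _] Ux; apply: contrapT => /zerosE zx.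
by have : (U `&` zeros) x by []; rewrite U0.
Qed.

(** The chart is the displacement from [x]: on a small star it is well defined by [step_inj_disp],
    and injective because [x] is regular. *)
Lemma chart_exists (x : X) : regular x ->
  exists U phi, translation_chart U phi /\ U x.
Proof.
move=> rx; have [r r0 hr] := near_point_radius x.
pose phi y : V := xget 0 [set d : V | (forall k, `|d k 0| < r) /\ step x d y].
have phiE (d : V) y : (forall k, `|d k 0| < r) -> step x d y -> phi y = d.
  move=> hd hy; rewrite /phi; case: xgetP => [e _ [he hye]|/(_ d)[]//].
  by apply: step_inj_disp hye hy; exact: hr.
have loc y : star x r y -> \forall e \near (0 : V), forall y', step y e y' ->
    star x r y' /\ phi y' = phi y + e.
  move=> [d hd hy]; apply: filterS (near_box hd) => e he y' hy'.
  have hxy' := step_trans (hr d hd) hy hy'.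
  by split; [exists (d + e)|rewrite (phiE _ _ he hxy') (phiE _ _ hd hy)].
exists (star x r), phi; split; last first.
  by exists 0; [move=> k; rewrite mxE normr0|exact: step0].
split.
- split; first exact: star_open.
  rewrite -subset0 => y [[d hd hy] /zerosE]; apply.
  exact: regular_step (hr _ hd) hy.
- move=> y y' /[!inE] -[d hd hy] [d' hd' hy'].
  by rewrite (phiE _ _ hd hy) (phiE _ _ hd' hy') => e; rewrite -e in hy'; exact: step_unique hy'.
- move=> y hy A; rewrite nbhs_simpl /= => /near_shiftP hA.
  by apply/nbhs_step; apply: filterS2 hA (loc y hy) => e Ae h y' /h[_ /= ->].
- move=> W oW sW; rewrite openE => _ [y Wy <-]; apply/near_shiftP.
  have /nbhs_step hW : nbhs y W by exact: open_nbhs_nbhs.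
  near=> e.
  have [y' hy'] : exists y', step y e y' by apply: step_exists; near: e; exact: near_near_point.
  have [_ <-] : star x r y' /\ phi y' = phi y + e.
    by move: y' hy'; near: e; apply: loc; exact: sW.
  by exists y' => //; move: y' hy'; near: e.
- move=> i p hp hx; apply/near_shiftP; apply: filterS (loc _ hx) => e he hpe.
  have [|_ ->] := he (pt i (p + e)); first by exists i, p.
  by rewrite addrAC subrr add0r addrAC subrr add0r.
Unshelve. all: by end_near.
Qed.

(** Injectivity of the chart recognises [h z'] as the end point of the displacement; conversely the
    chart of [chart_exists] serves. *)
Lemma translation_mapE D (h : V -> X) :
  translation_map D h <-> local_translation D h.
Proof.
split=> [H z Dz|H z Dz].
  have [U [phi [hc Uz hz]]] := H z Dz; split; first exact: chart_regular hc Uz.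
  apply/near_shiftP; move/near_shiftP : hz => hz.
  have hn := near_near_point (h z); have hs := chart_step hc Uz.
  near=> d => Dzd.
  have [y hy] : exists y, step (h z) d y by apply: step_exists; near: d.
  have [Uy ey] : U y /\ phi y = phi (h z) + d by move: y hy; near: d.
  have [Uzd ezd] : U (h (z + d)) /\ phi (h (z + d)) - phi (h z) = z + d - z.
    by move: Dzd; near: d.
  rewrite addrAC subrr add0r in ezd *.
  suff -> : h (z + d) = y by [].
  have [_ inj _ _ _] := hc; apply: inj; rewrite ?inE//.
  by rewrite ey [RHS]addrC; apply/eqP; rewrite -subr_eq; apply/eqP.
have [rz hz] := H z Dz; have [U [phi [hc Uz]]] := chart_exists rz.
exists U, phi; split=> //; apply/near_shiftP; move/near_shiftP : hz => hz.
apply: filterS2 hz (chart_step hc Uz) => d hz hs Dzd.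
have := hz Dzd; rewrite [z + d]addrC addrK => /hs[? ->].
by rewrite [phi (h z) + d]addrC addrK.
Unshelve. all: by end_near.
Qed.

End Topology.

(** * Affine maps *)

Section LinearPlane.
Context {R : realType}.
Local Notation V := 'cV[R]_2.

Lemma mulmx2E (B : 'M[R]_2) (d : V) k :
  (B *m d) k 0 = B k 0 * d 0 0 + B k 1 * d 1 0.
Proof. by rewrite mxE big_ord_recl big_ord1; congr (_ + B _ _ * d _ _); exact: val_inj. Qed.

Lemma mulmx_continuous (B : 'M[R]_2) : continuous (mulmx B : V -> V).
Proof.
move=> z A; rewrite nbhs_simpl /= => /near_vecP[r r0 hA].
(* [M] exceeds the sum of absolute values of each row; the summand 1 keeps it positive when [B] is
   0. *)
apply/near_vecP; pose M := 1 + (`|B 0 0| + `|B 0 1| + `|B 1 0| + `|B 1 1|).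
have M1 : 0 < M by rewrite /M ltr_pwDl// !addr_ge0.
exists (r / M); first by rewrite divr_gt0.
move=> d hd; apply: hA => k; rewrite !mulmx2E.
rewrite (_ : _ - _ = B k 0 * (d 0 0 - z 0 0) + B k 1 * (d 1 0 - z 1 0)); last by ring.
apply: le_lt_trans (ler_normD _ _) _; rewrite !normrM.
have h0 := hd 0; have h1 := hd 1.
rewrite !ltr_pdivlMr// in h0 h1.
set a := `|d 0 0 - _| in h0 *; set b := `|d 1 0 - _| in h1 *.
have a0 : 0 <= a := normr_ge0 _; have b0 : 0 <= b := normr_ge0 _.
have hM : `|B k 0| + `|B k 1| < M.
  have : forall k l, 0 <= `|B k l| by move=> *; exact: normr_ge0.
  by rewrite /M; move: k; apply: ord2_ind => H; have := H 0 0; have := H 0 1;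
    have := H 1 0; have := H 1 1; lra.
have n0 := normr_ge0 (B k 0); have n1 := normr_ge0 (B k 1).
have [ab|ab] := leP a b.
  apply: le_lt_trans (_ : b * (`|B k 0| + `|B k 1|) < r); first by nra.
  by apply: le_lt_trans h1; rewrite ler_wpM2l// ltW.
apply: le_lt_trans (_ : a * (`|B k 0| + `|B k 1|) < r).
  by rewrite mulrDr; have := ltW ab; nra.
by apply: le_lt_trans h0; rewrite ler_wpM2l// ltW.
Qed.

Lemma near0_mulmx (B : 'M[R]_2) (P : V -> Prop) :
  (\forall d \near (0 : V), P d) -> \forall d \near (0 : V), P (B *m d).
Proof. by move=> hP; apply: (@mulmx_continuous B 0 P); rewrite mulmx0. Qed.

Lemma is_diff_mulmx (B : 'M[R]_2) (z : V) : is_diff z (mulmx B : V -> V) (mulmx B).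
Proof.
apply: DiffDef; first exact/linear_differentiable/mulmx_continuous.
by rewrite diff_lin//; exact: mulmx_continuous.
Qed.

End LinearPlane.

Section Affine.
Context {R : realType} {n : nat}.
Local Notation V := 'cV[R]_2.
Local Notation usq := (unit_square R).

(** Quantifying over all end points [y] gives a meaning to the condition at zeros, where a
    displacement has several. *)
Definition affine_at (s t s' t' : 'S_n) (f : surface R s t -> surface R s' t')
    (B : 'M[R]_2) (x : surface R s t) : Prop :=
  \forall d \near (0 : V), forall y, step x d y -> step (f x) (B *m d) (f y).

Definition affine_map (s t s' t' : 'S_n) (f : surface R s t -> surface R s' t')
    (B : 'M[R]_2) : Prop := forall x, affine_at f B x.

Lemma affine_at_continuous (s t s' t' : 'S_n)
    (f : surface R s t -> surface R s' t') B x :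
  affine_at f B x -> {for x, continuous f}.
Proof.
rewrite /affine_at => hf A; rewrite nbhs_simpl => /nbhs_step/(near0_mulmx B) hA.
by apply/nbhs_step; apply: filterS2 hf hA => d h1 h2 y /h1/h2.
Qed.

(** This makes regularity a property of the germ of [step], which injective affine maps reflect. *)
Lemma regularP (s t : 'S_n) (x : surface R s t) : regular x <->
  \forall d \near (0 : V), forall y y', step x d y -> step x d y' -> y = y'.
Proof.
split=> [rx|hx i j p hp ei ej].
  by apply: (@nearW _ (nbhs (0 : V))) => d y y'; exact: step_unique.
have /near_vecP[r r0 hr] := hx.
(* The displacement points from [p] to the centre of the square, so [p + d] is interior and belongs
   to a single square. *)
pose e := Num.min (r / 2) (1 / 2); pose d : V := e *: (vec2 (2^-1) (2^-1) - p).
have [e0 [er e1]] : 0 < e /\ e < r /\ e <= 1 / 2.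
  by rewrite /e lt_min gt_min ge_min lexx orbT divr_gt0//; lra.
have dE k : d k 0 = e * (2^-1 - p k 0).
  by rewrite /d !mxE; case: ifP.
have hd k : `|d k 0 - (0 : V) k 0| < r.
  rewrite [(0 : V) k 0]mxE subr0 dE normrM gtr0_norm//.
  apply: le_lt_trans er; apply: ler_piMr; [exact: ltW|]; rewrite ler_norml; have := hp k; lra.
have hpd k : 0 < (p + d) k 0 < 1.
  rewrite mxE dE; have := hp k; nra.
have hpd' : usq (p + d) by move=> k; have := hpd k; lra.
apply: (@pt_inj_edge _ _ s t 0 i j (p + d)) => //.
by apply: (hr d hd); [exists i, p|exists j, p].
Qed.

Lemma affine_regular (s t s' t' : 'S_n) (f : surface R s t -> surface R s' t') B x :
  injective f -> affine_at f B x -> regular (f x) -> regular x.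
Proof.
rewrite /affine_at => fI hf /regularP/(near0_mulmx B) rf; apply/regularP.
apply: filterS2 hf rf => d h1 h2 y y' /h1 hy /h1 hy'.
by apply: fI; exact: h2 hy hy'.
Qed.

Lemma affine_comp (s t s' t' s2 t2 : 'S_n) (f : surface R s t -> surface R s' t')
    (g : surface R s' t' -> surface R s2 t2) B C x :
  affine_at f B x -> affine_at g C (f x) -> affine_at (g \o f) (C *m B) x.
Proof.
rewrite /affine_at => hf /(near0_mulmx B) hg.
by apply: filterS2 hf hg => d h1 h2 y /h1/h2; rewrite mulmxA.
Qed.

Lemma near_exists_step (s t : 'S_n) (x : surface R s t) (P : V -> Prop) :
  (\forall d \near (0 : V), P d) -> \forall y \near x, exists2 d, P d & step x d y.
Proof. by move=> hP; apply/nbhs_step; apply: filterS hP => d Pd y; exists d. Qed.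

End Affine.

(** * Affine diffeomorphisms expressed by displacements *)

Section AffineDiffeo.
Context {R : realType} {n : nat} {s t : 'S_n}.
Local Notation V := 'cV[R]_2.
Local Notation X := (surface R s t).
Implicit Types (f : X -> X) (A : 'M[int]_2).

Lemma affine_diffeoI f f' A (B : 'M[R]_2) :
  \det A = 1 -> cancel f f' -> cancel f' f ->
  affine_map f (map_mx intr A) -> affine_map f' B -> affine_diffeo f A.
Proof.
move=> dA fK f'K hf hf'.
have cf : continuous f by move=> x; exact: affine_at_continuous (hf x).
have reg x : regular x <-> regular (f x).
  split=> rx; last exact: affine_regular (can_inj fK) (hf x) rx.
  by apply: affine_regular (can_inj f'K) (hf' _) _; rewrite fK.
split=> //.
- split=> //; exists f'; split=> // x; exact: affine_at_continuous (hf' x).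
- apply/seteqP; split=> [_ [x /zerosE zx <-]|x /zerosE zx].
    by apply/zerosE => /(reg _).2.
  by exists (f' x); rewrite ?f'K//; apply/zerosE => /(reg _).1; rewrite f'K.
move=> x zx; have rx : regular x by apply: contrapT => /zerosE.
have [U [phi [hU Ux]]] := chart_exists rx.
have [U' [phi' [hU' Ufx]]] := chart_exists ((reg x).1 rx).
set B' := map_mx intr A in hf *.
pose h := cst (phi' (f x) - B' *m phi x) + (mulmx B' : V -> V).
exists U, phi, U', phi', h; split; [by split|by split| |].
  apply/nbhs_step.
  have h1 := near0_mulmx B' (chart_step hU' Ufx).
  have h2 := chart_step hU Ux; have := hf x; rewrite /affine_at => h3.
  apply: filterS3 h1 h2 h3 => d h1 h2 h3 y hy; have [_ e2] := h2 _ hy.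
  have [_ e1] := h1 _ (h3 _ hy).
  by rewrite e2 e1 /h fctE /cst mulmxDr addrA subrK.
have hd := is_diff_mulmx B' (phi x).
apply: (is_diff_eq (is_diffD (is_diff_cst _ _) hd)); exact: add0r.
Qed.

(** The definition prescribes a derivative at one point at a time, in charts that vary with the
    point. Read in fixed charts around [x] and [f x], the map [K] has derivative [B] at every nearby
    point; the mean value theorem then makes it affine. *)
Lemma affine_diffeoE f A : affine_diffeo f A -> forall x, regular x ->
  regular (f x) /\ affine_at f (map_mx intr A) x.
Proof.
move=> [_ [cf [f' [cf' fK f'K]]] fz hc]; set B := map_mx intr A.
have reg x : regular x -> regular (f x).
  move=> rx; apply: contrapT => /zerosE; rewrite -fz => -[y /zerosE + e].
  by rewrite (can_inj fK e).
move=> x rx; split; first exact: reg.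
have zx : ~ zeros x by move/zerosE.
have [U [phi [U' [phi' [h [[hU Ux] [hU' Ufx] _ _]]]]]] := hc x zx.
have oU' : open U' by case: hU' => -[].
have [r [r0 hr hrU]] : exists r : R, [/\ 0 < r,
    forall d : V, (forall k, `|d k 0| < r) -> near_point x d
    & forall d : V, (forall k, `|d k 0| < r) -> forall y, step x d y -> U' (f y)].
  have hfU : \forall y \near x, U' (f y) by apply: cf; exact: open_nbhs_nbhs.
  have /near_vecP[r r0 hr] : \forall d \near (0 : V),
      near_point x d /\ (forall y, step x d y -> U' (f y)).
    by apply: filterI; [exact: near_near_point|exact/nbhs_step].
  have {}hr (d : V) : (forall k, `|d k 0| < r) ->
      near_point x d /\ (forall y, step x d y -> U' (f y)).
    by move=> hd; apply: hr => k; rewrite mxE subr0.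
  by exists r; split=> // d /hr[].
pose shift_pt (d : V) : X := xget x (step x d).
have shiftE (d : V) : (forall k, `|d k 0| < r) -> step x d (shift_pt d).
  move=> hd; have [y hy] := step_exists (hr d hd).
  by rewrite /shift_pt; case: xgetP => [? _|/(_ y)].
pose K d := phi' (f (shift_pt d)).
(* The charts supplied at [y0] and [f y0] differ from the fixed ones by translations, whence the
   constants [z] and [c]. *)
have dK (d0 : V) : (forall k, `|d0 k 0| < r) -> exists (h2 : V -> V) z c,
    (\forall e \near (0 : V), K (d0 + e) = c + h2 (z + e)) /\ is_diff z h2 (mulmx B).
  move=> hd0; have := shiftE _ hd0; set y0 := shift_pt d0 => hy0.
  have ry0 : regular y0 by exact: regular_step (hr _ hd0) hy0.
  have zy0 : ~ zeros y0 by move/zerosE.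
  have [W [psi [W' [psi' [h2 [[hW Wy] [hW' Wfy] hh2 dh2]]]]]] := hc y0 zy0.
  exists h2, (psi y0), (phi' (f y0) - psi' (f y0)); split=> //.
  have h1 := step_near_assoc rx (hr _ hd0) hy0.
  have h3 := chart_step hW Wy.
  move/nbhs_step : hh2 => h4.
  have Ufy0 : U' (f y0) by exact: hrU hy0.
  have h5 : \forall e \near (0 : V), forall y, step y0 e y ->
      phi' (f y) - phi' (f y0) = psi' (f y) - psi' (f y0).
    apply/(nbhs_step y0 [set y | phi' (f y) - phi' (f y0) = psi' (f y) - psi' (f y0)]).
    apply: (cf y0 [set w | phi' w - phi' (f y0) = psi' w - psi' (f y0)]).
    apply/nbhs_step; apply: filterS2 (chart_step hU' Ufy0) (chart_step hW' Wfy).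
    move=> e a1 a2 w hw; have [_ e1] := a1 _ hw; have [_ e2] := a2 _ hw.
    by rewrite /= e1 e2 ![_ + e]addrC !addrK.
  near=> e.
  have he : step x (d0 + e) (shift_pt (d0 + e)).
    by apply: shiftE; near: e; exact: near_box.
  rewrite /K; set y := shift_pt (d0 + e) in he *.
  have hy : step y0 e y by move: y he; near: e.
  have [_ e3] : W y /\ psi y = psi y0 + e by move: y hy {he}; near: e.
  have e4 : psi' (f y) = h2 (psi y) by move: y hy {he e3}; near: e.
  have e5 : phi' (f y) - phi' (f y0) = psi' (f y) - psi' (f y0).
    by move: y hy {he e3 e4}; near: e.
  rewrite -e3 -e4; apply/eqP; rewrite -subr_eq0; apply/eqP.
  by rewrite -[phi' (f y)](subrK (phi' (f y0))) e5; apply/colP => k; rewrite !mxE; ring.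
(* K - B has derivative 0 along [0, d]. *)
have KE (d : V) : (forall k, `|d k 0| < r) -> K d = K 0 + B *m d.
  move=> hd; apply/colP => j.
  pose G (u : R) := (K (u *: d) - u *: (B *m d)) j 0.
  have dG (u : R) : 0 <= u <= 1 -> is_derive u 1 G 0.
    move=> hu; have hud k : `|(u *: d) k 0| < r.
      rewrite mxE normrM ger0_norm; last by case/andP: hu.
      by apply: le_lt_trans (hd k); apply: ler_piMl => //; case/andP: hu.
    have [h2 [z [c [hK dh2]]]] := dK _ hud.
    pose F (v : R) : V := c + h2 (z + (v - u) *: d) - v *: (B *m d).
    pose G' := (fun N : V => N j 0 : R) \o F.
    have nG : {near u, G' =1 G}.
      have : \forall v \near u, K (u *: d + (v - u) *: d) = c + h2 (z + (v - u) *: d).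
        suff : (fun v : R => (v - u) *: d) @ u --> (0 : V) by move/(_ _ hK).
        rewrite -[X in _ --> X](scale0r d) -(subrr u).
        by apply: cvgZr_tmp => //; apply: cvgB => //; exact: cvg_cst.
      apply: filterS => v; rewrite -scalerDl addrC subrK => e.
      by rewrite /G' /G /= /F e.
    apply: near_eq_is_derive nG _.
    have dF : is_diff u F (fun v : R => B *m (v *: d) - v *: (B *m d)).
      pose g := cst z + (( *:%R ^~ d) \o (id - cst u)).
      have dg : is_diff u g (0 + (( *:%R ^~ d) \o (id - 0))).
        apply: is_diffD; apply: is_diff_comp.
      have dz : is_diff (g u) h2 (mulmx B).
        by rewrite /g !fctE /= subrr scale0r addr0.
      have dc : is_diff u (cst c) 0 by exact: is_diff_cst.
      have dl := is_diff_scalel u (B *m d).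
      have := is_diffB (is_diffD dc (is_diff_comp dg dz)) dl.
      move/is_diff_eq; apply; apply/funext => v.
      by rewrite !fctE /= add0r subr0 add0r.
    have dcoord := differentiable_coord (F u) j 0.
    have dG' : differentiable G' u.
      by apply: differentiable_comp => //; exact: ex_diff dF.
    apply: DeriveDef; first exact: diff_derivable.
    rewrite deriveE// diff_comp//.
    by rewrite /= diff_val !scale1r subrr linear0.
  have [|||c _] := @MVT_segment _ G (cst 0) 0 1.
  - exact: ler01.
  - by move=> u; rewrite in_itv /= => hu; apply: dG; lra.
  - apply: derivable_within_continuous => u; rewrite in_itv /= => hu.
    by have [] := dG u hu.
  rewrite /cst mul0r /G !scale1r !scale0r subr0 => /eqP.
  by rewrite subr_eq0 => /eqP; rewrite !mxE => /eqP; rewrite subr_eq => /eqP.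
have K0 : K 0 = phi' (f x).
  by rewrite /K; congr (phi' (f _)); apply/step0E/shiftE => k; rewrite mxE normr0.
have hB := near0_mulmx B (chart_step hU' Ufx).
have hB2 := near0_mulmx B (near_near_point (f x)).
rewrite /affine_at; near=> d => y hy.
have hd k : `|d k 0| < r.
  suff : forall k, `|(0 + d) k 0| < r by rewrite add0r.
  by near: d; apply: near_box => l; rewrite mxE normr0.
have [y' hy'] : exists y', step (f x) (B *m d) y' by apply: step_exists; near: d.
have [Uy' ey'] : U' y' /\ phi' y' = phi' (f x) + B *m d by move: y' hy'; near: d.
suff -> : f y = y' by [].
have [_ inj _ _ _] := hU'; apply: inj; rewrite ?inE//; first exact: hrU hy.
by rewrite ey' -K0 -KE// /K (step_unique rx hy (shiftE d hd)).
Unshelve. all: by end_near.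
Qed.

End AffineDiffeo.

(** * Rows of squares and elementary isomorphisms *)

Section Permz.
Context {n : nat}.
Local Open Scope group_scope.

Definition permz (u : 'S_n) (z : int) : 'S_n :=
  match z with Posz m => u ^+ m | Negz m => u ^- m.+1 end.

Lemma permzS u z : permz u (z + 1)%R = permz u z * u.
Proof.
case: z => [m|[|m]].
- by rewrite -(PoszD m 1%N) addn1 /= expgSr.
- by rewrite /= mulVg.
- rewrite (_ : (Negz m.+1 + 1)%R = Negz m)/=.
    by rewrite [u ^+ m.+2]expgS invMg mulgKV.
  by rewrite !NegzE -[in LHS]addn1 PoszD opprD subrK.
Qed.

Lemma permzD u z z' : permz u (z + z')%R = permz u z * permz u z'.
Proof.
elim/int_ind: z' => [|m IH|m IH].
- by rewrite addr0 mulg1.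
- by rewrite -addn1 PoszD addrA !permzS IH mulgA.
- apply: (mulIg u); rewrite -permzS -mulgA -permzS.
  by rewrite -addn1 PoszD opprD addrA !subrK.
Qed.

Lemma permz0 u : permz u 0 = 1. Proof. by []. Qed.
Lemma permz1 u : permz u 1%R = u. Proof. by rewrite /= expg1. Qed.
Lemma permzN1 u : permz u (-1)%R = u^-1. Proof. by rewrite /= expg1. Qed.
End Permz.

Section Lift.
Context {R : realType} {n : nat} {s t : 'S_n}.
Local Notation V := 'cV[R]_2.
Local Notation X := (surface R s t).
Local Notation usq := (unit_square R).

Lemma pt_surj_pair (x : X) : exists a : 'I_n * V, usq a.2 /\ x = pt a.1 a.2.
Proof. by have [i [p h]] := pt_surj x; exists (i, p). Qed.

Definition lift_pt (T : Type) (f : 'I_n -> V -> T) (x : X) : T :=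
  let a := sval (cid (pt_surj_pair x)) in f a.1 a.2.

Lemma lift_ptE (T : Type) (f : 'I_n -> V -> T) i p :
  (forall k j w, usq w -> usq (w - side k) ->
     f (@side_perm n s t k j) (w - side k) = f j w) ->
  usq p -> lift_pt f (pt i p) = f i p.
Proof.
move=> hf hp; rewrite /lift_pt; case: cid => -[j q] /= [hq e].
apply: (pt_ind (P := fun j q => f j q = f i p) _ hp hq e) => //.
by move=> k l w hw hwk; rewrite hf.
Qed.

(* The point at (a, b) from the south-west corner of Q_i, in the bi-infinite row of
   squares through Q_i; only meaningful for 0 <= b <= 1. *)
Definition hpt (i : 'I_n) (a b : R) : X :=
  pt (permz s (Num.floor a) i) (vec2 (a - (Num.floor a)%:~R) b).

Lemma usq_vec2 (a b : R) : 0 <= a <= 1 -> 0 <= b <= 1 -> usq (vec2 a b).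
Proof. by move=> ha hb; apply: ord2_ind; rewrite mxE. Qed.

(** At the right end [a = m + 1] the floor jumps to the next square of the row; the gluing
    identifies the two descriptions. *)
Lemma hptE i (a b : R) (m : int) : m%:~R <= a <= m%:~R + 1 -> 0 <= b <= 1 ->
  hpt i a b = pt (permz s m i) (vec2 (a - m%:~R) b).
Proof.
move=> /andP[h1]; rewrite le_eqVlt => /orP[/eqP am|h2] hb; last first.
  rewrite /hpt (_ : Num.floor a = m)//.
  by apply/eqP; rewrite floor_eq h1 intrD.
rewrite /hpt (_ : Num.floor a = m + 1); last first.
  by apply/eqP; rewrite floor_eq !intrD am lexx; lra.
rewrite am intrD subrr permzS permM [m%:~R + 1]addrC addrK.
rewrite -(@pt_glue _ _ s t 0 _ (vec2 1 b)).
- by congr (pt (s _) _); apply: vec2_eq; rewrite !mxE /=; ring.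
- by apply: usq_vec2 => //; lra.
- by apply: ord2_ind; rewrite !mxE /=; lra.
Qed.

Lemma hpt_pt i (p : V) : usq p -> hpt i (p 0 0) (p 1 0) = pt i p.
Proof.
move=> hp; rewrite (@hptE _ _ _ 0); [|by have := hp 0; lra|exact: hp].
by rewrite permz0 perm1; congr pt; apply: vec2_eq; rewrite !mxE //= subr0.
Qed.

Lemma hpt_shift i (a b : R) (m : int) :
  hpt i (a + m%:~R) b = hpt (permz s m i) a b.
Proof.
rewrite /hpt (_ : Num.floor (a + m%:~R) = Num.floor a + m); last first.
  by rewrite floorDrz ?intr_int// intrKfloor.
rewrite addrC permzD permM; congr (pt _ (vec2 _ _)); rewrite intrD; ring.
Qed.

Lemma hpt_step i (a b : R) : 0 <= b <= 1 -> \forall d \near (0 : V),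
  0 <= b + (d : V) 1 0 <= 1 -> step (hpt i a b) d (hpt i (a + d 0 0) (b + d 1 0)).
Proof.
move=> hb.
have [r r0 hr] : exists2 r : R, 0 < r & forall d : R, `|d| < r -> exists m : int,
    (m%:~R <= a <= m%:~R + 1) /\ (m%:~R <= a + d <= m%:~R + 1).
  pose m := Num.floor a; have := floor_le a; have := floorD1_gt a.
  rewrite -/m intrD => h1 h2.
  (* At the junction of two squares, the one towards which [d] points is chosen. *)
  have [am|am] := eqVneq a m%:~R.
    exists 1 => // d; rewrite ltr_norml => hd.
    have [d0|d0] := leP 0 d; first by exists m; split; lra.
    by exists (m - 1); rewrite intrD; split; lra.
  have am' : m%:~R < a by rewrite lt_neqAle eq_sym am.
  exists (Num.min (a - m%:~R) (m%:~R + 1 - a)); first by rewrite lt_min; lra.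
  move=> d; rewrite lt_min !ltr_norml => hd.
  by exists m; split; lra.
apply/near_vecP; exists r => // d hd hbd.
have [|m [h1 h2]] := hr (d 0 0); first by have := hd 0; rewrite mxE subr0.
rewrite !(hptE _ _ (m := m))//.
exists (permz s m i), (vec2 (a - m%:~R) b).
have e : vec2 (a - m%:~R) b + d = vec2 (a + d 0 0 - m%:~R) (b + d 1 0).
  by apply: vec2_eq; rewrite !mxE /=; ring.
by split; rewrite ?e//; apply: usq_vec2 => //; lra.
Qed.

End Lift.

Section Isomorphisms.
Context {R : realType} {n : nat}.
Local Notation V := 'cV[R]_2.
Local Notation usq := (unit_square R).
Implicit Types s t : 'S_n.

Definition shear_mx (e : int) : 'M[int]_2 := 1%:M + e *: delta_mx 0 1.

Lemma shear_mxE e (p : V) :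
  map_mx intr (shear_mx e) *m p = vec2 (p 0 0 + e%:~R * p 1 0) (p 1 0).
Proof. by apply: vec2_eq; rewrite mulmx2E !mxE /=; ring. Qed.

Definition shear s t t' (e : int) (x : surface R s t') : surface R s t :=
  lift_pt (fun i p => hpt i (p 0 0 + e%:~R * p 1 0) (p 1 0)) x.

Lemma shear_pt s t t' e i (p : V) : t' = (permz s e * t)%g -> usq p ->
  shear t e (pt i p : surface R s t') = hpt i (p 0 0 + e%:~R * p 1 0) (p 1 0).
Proof.
move=> et' hp; apply: lift_ptE hp => k j w hw hwk.
have wk1 : w k 0 = 1 by have := hw k; have := hwk k; rewrite !mxE !eqxx /=; lra.
move: k wk1 hwk; apply: ord2_ind => wk1 hwk; rewrite !mxE /= wk1 mulr1n.
  rewrite subrr subr0 add0r -[side_perm 0 j]/(s j) (_ : s j = permz s 1 j).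
    by rewrite -hpt_shift addrC.
  by rewrite permz1.
rewrite subrr subr0 mulr0 addr0 mulr1 -[side_perm 1]/t' hpt_shift.
have h0 : 0 <= w 0 0 <= 1 := hw 0.
have := @hpt_pt R n s t (t' j) (vec2 (w 0 0) 0); rewrite !mxE /= => -> //; last first.
  by apply: usq_vec2 => //; lra.
have := @hpt_pt R n s t (permz s e j) (vec2 (w 0 0) 1); rewrite !mxE /= => ->; last first.
  by apply: usq_vec2 => //; lra.
have e1 : vec2 (w 0 0) 0 = vec2 (w 0 0) 1 - side 1.
  by apply: vec2_eq; rewrite !mxE /=; ring.
rewrite et' permM -[t _]/(@side_perm n s t 1 _) e1 pt_glue// -?e1.
  by apply: usq_vec2 => //; lra.
by apply: usq_vec2 => //; lra.
Qed.

Lemma shear_hpt s t t' e i (a b : R) : t' = (permz s e * t)%g -> 0 <= b <= 1 ->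
  shear t e (hpt i a b : surface R s t') = hpt i (a + e%:~R * b) b.
Proof.
move=> et' hb; pose m := Num.floor a.
have := floor_le a; have := floorD1_gt a; rewrite -/m intrD => h1 h2.
rewrite (hptE _ _ (m := m))//; last lra.
rewrite shear_pt//; last by apply: usq_vec2 => //; lra.
by rewrite !mxE /= -hpt_shift; congr (hpt _ _ _); ring.
Qed.

Lemma shear_affine s t t' e : t' = (permz s e * t)%g ->
  affine_map (@shear s t t' e) (map_mx intr (shear_mx e)).
Proof.
move=> et' x; rewrite /affine_at.
suff h : \forall d \near (0 : V), forall i p, usq p -> x = pt i p -> usq (p + d) ->
    step (shear t e x) (map_mx intr (shear_mx e) *m d) (shear t e (pt i (p + d) : surface R s t')).
  by apply: filterS h => d hd y [i [p [hp hpd ex ->]]]; exact: hd.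
apply: near_rep => i p hp ex; rewrite ex shear_pt//.
have hs := @hpt_step R n s t i (p 0 0 + e%:~R * p 1 0) (p 1 0) (hp 1).
apply: filterS (near0_mulmx (map_mx intr (shear_mx e)) hs) => d hd hpd.
rewrite shear_pt//; move: hd; rewrite shear_mxE !mxE /=.
have := hpd 1; rewrite mxE => hb /(_ hb).
by congr (step _ _ (hpt _ _ _)); ring.
Qed.

Lemma shearK s t t' e : t' = (permz s e * t)%g ->
  cancel (@shear s t t' e) (@shear s t' t (- e)).
Proof.
move=> et' x; have [i [p [hp ->]]] := pt_surj x; rewrite shear_pt//.
rewrite shear_hpt; last exact: hp.
  by rewrite -[RHS]hpt_pt//; congr (hpt _ _ _); rewrite mulrNz; ring.
by rewrite et' mulgA -permzD addNr mul1g.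
Qed.

Definition swap_mx : 'M[int]_2 := delta_mx 0 1 + delta_mx 1 0.

Lemma swap_mxE (p : V) : map_mx intr swap_mx *m p = vec2 (p 1 0) (p 0 0).
Proof. by apply: vec2_eq; rewrite mulmx2E !mxE /=; ring. Qed.

(** The reflection in the diagonal. It reverses orientation, and reduces statements on columns to
    statements on rows. *)
Definition flip s t (x : surface R t s) : surface R s t :=
  lift_pt (fun i p => pt i (vec2 (p 1 0) (p 0 0))) x.

Lemma usq_swap (p : V) : usq p -> usq (vec2 (p 1 0) (p 0 0)).
Proof. by move=> hp; apply: usq_vec2; exact: hp. Qed.

Lemma flip_pt s t i (p : V) : usq p ->
  flip (pt i p : surface R t s) = pt i (vec2 (p 1 0) (p 0 0)).
Proof.
move=> hp; apply: lift_ptE hp => k j w hw hwk.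
have e l : vec2 ((w - side l) 1 0) ((w - side l) 0 0) =
    vec2 (w 1 0) (w 0 0) - side (1 - l) :> V.
  move: l; apply: ord2_ind; apply: vec2_eq; rewrite !mxE //=; ring.
rewrite e -(@pt_glue _ _ s t (1 - k) j) -?e; try exact: usq_swap.
by congr (pt (fun_of_perm _ _) _); rewrite /side_perm; move: k {hwk}; apply: ord2_ind.
Qed.

Lemma flip_affine s t : affine_map (@flip s t) (map_mx intr swap_mx).
Proof.
move=> x; apply: (@nearW _ (nbhs (0 : V))) => d y [i [p [hp hpd -> ->]]].
rewrite !flip_pt//; exists i, (vec2 (p 1 0) (p 0 0)).
have e : vec2 (p 1 0) (p 0 0) + map_mx intr swap_mx *m d =
    vec2 ((p + d) 1 0) ((p + d) 0 0).
  by rewrite swap_mxE; apply: vec2_eq; rewrite !mxE.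
by rewrite e; split=> //; exact: usq_swap.
Qed.

Lemma flipK s t : cancel (@flip s t) (@flip t s).
Proof.
move=> x; have [i [p [hp ->]]] := pt_surj x.
rewrite flip_pt// flip_pt; last exact: usq_swap.
by congr pt; apply: vec2_eq; rewrite !mxE.
Qed.

Definition relabel s t s' t' (w : 'S_n) (x : surface R s t) : surface R s' t' :=
  lift_pt (fun i p => pt (w i) p) x.

Section Relabel.
Variables (s t s' t' w : 'S_n).
Hypothesis hs : forall i, s' (w i) = w (s i).
Hypothesis ht : forall i, t' (w i) = w (t i).

Lemma relabel_pt i (p : V) : usq p ->
  relabel s' t' w (pt i p : surface R s t) = pt (w i) p.
Proof.
move=> hp; apply: lift_ptE hp => k j q hq hqk.
rewrite -(@pt_glue _ _ s' t' k (w j))//; congr pt.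
by move: k hqk; apply: ord2_ind => _; rewrite /side_perm /= ?hs ?ht.
Qed.

Lemma relabel_affine : affine_map (@relabel s t s' t' w) 1%:M.
Proof.
move=> x; apply: (@nearW _ (nbhs (0 : V))) => d y [i [p [hp hpd -> ->]]].
by rewrite !relabel_pt// mul1mx; exists (w i), p.
Qed.
End Relabel.

Lemma relabelK s t s' t' (w : 'S_n) :
  (forall i, s' (w i) = w (s i)) -> (forall i, t' (w i) = w (t i)) ->
  cancel (@relabel s t s' t' w) (@relabel s' t' s t w^-1%g).
Proof.
move=> hs ht x; have [i [p [hp ->]]] := pt_surj x.
rewrite !relabel_pt// => [|j|j]; first by rewrite permK.
- by apply: (@perm_inj _ w); rewrite -hs !permKV.
- by apply: (@perm_inj _ w); rewrite -ht !permKV.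
Qed.

(* The last clause says that F preserves the labels of the south-west sectors, hence
   those of the saddle connections. *)
Definition marked_iso s' t' s t (A : 'M[int]_2) : Prop :=
  exists (F : surface R s' t' -> surface R s t) G (C : 'M[int]_2),
  [/\ cancel F G /\ cancel G F, A *m C = 1%:M /\ C *m A = 1%:M,
      affine_map F (map_mx intr A), affine_map G (map_mx intr C)
    & forall i, \forall z \near (0 : V), (forall k, 0 <= (z : V) k 0) ->
        F (pt i z) = pt i (map_mx intr A *m z)].

Lemma affine_map_comp s t s' t' s2 t2 (f : surface R s t -> surface R s' t')
    (g : surface R s' t' -> surface R s2 t2) (A B : 'M[int]_2) :
  affine_map f (map_mx intr A) -> affine_map g (map_mx intr B) ->
  affine_map (g \o f) (map_mx intr (B *m A)).
Proof. by move=> hf hg x; rewrite map_mxM; apply: affine_comp. Qed.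

(** As [B] has nonnegative entries, it keeps small vectors in the first quadrant, where the label
    clause of [F] applies. *)
Lemma marked_iso_comp s2 t2 s' t' s t (A B : 'M[int]_2) :
  (forall i j, 0 <= B i j) -> marked_iso s' t' s t A ->
  marked_iso s2 t2 s' t' B -> marked_iso s2 t2 s t (A *m B).
Proof.
move=> B0 [F [G [C [[FG GF] [AC CA] hF hG lF]]]].
move=> [F' [G' [C' [[FG' GF'] [AC' CA'] hF' hG' lF']]]].
exists (F \o F'), (G' \o G), (C' *m C); split.
- by split=> x /=; rewrite ?FG ?FG' ?GF' ?GF.
- by split; rewrite -!mulmxA; [rewrite (mulmxA B) AC' mul1mx|
    rewrite (mulmxA C) CA mul1mx].
- exact: affine_map_comp hF' hF.
- exact: affine_map_comp hG hG'.
move=> i; apply: filterS2 (lF' i) (near0_mulmx (map_mx intr B) (lF i)).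
move=> z h1 h2 z0; rewrite /= h1// map_mxM -mulmxA h2// => k.
by rewrite mulmx2E !mxE addr_ge0// mulr_ge0// ler0z.
Qed.

Lemma marked_iso_id s t : marked_iso s t s t 1%:M.
Proof.
exists id, id, 1%:M; split=> //; rewrite ?mul1mx//.
- by move=> x; apply: (@nearW _ (nbhs (0 : V))) => d y; rewrite map_mx1 mul1mx.
- by move=> x; apply: (@nearW _ (nbhs (0 : V))) => d y; rewrite map_mx1 mul1mx.
- by move=> i; apply: (@nearW _ (nbhs (0 : V))) => d y; rewrite map_mx1 mul1mx.
Qed.

Lemma near0_usq : \forall z \near (0 : V), (forall k, 0 <= (z : V) k 0) -> usq z.
Proof.
apply/near_vecP; exists 1 => // d hd d0 k; rewrite d0 /=.
by have := hd k; rewrite mxE subr0 ltr_norml; lra.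
Qed.

Lemma marked_iso_shear s t : marked_iso s (s * t)%g s t (shear_mx 1).
Proof.
have e1 : (s * t)%g = (permz s 1 * t)%g by rewrite permz1.
have e2 : t = (permz s (-1) * (s * t))%g by rewrite permzN1 mulKg.
exists (@shear s t (s * t)%g 1), (@shear s (s * t)%g t (- 1)), (shear_mx (-1)); split.
- by split; [exact: shearK|have := @shearK s (s * t)%g t (-1) e2; rewrite opprK].
- by split; apply/matrixP; apply: ord2_ind; apply: ord2_ind;
    rewrite !mxE !big_ord_recl big_ord0 !mxE /=; ring.
- exact: shear_affine.
- exact: shear_affine.
move=> i; apply: filterS2 near0_usq (near0_mulmx (map_mx intr (shear_mx 1)) near0_usq).
move=> z h1 h2 z0; rewrite shear_pt//; last exact: h1.
have : usq (map_mx intr (shear_mx 1) *m z).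
  apply: h2; apply: ord2_ind; rewrite shear_mxE !mxE //= addr_ge0//.
  by rewrite mul1r.
by rewrite shear_mxE => /(@hpt_pt _ _ s t i) <-; rewrite !mxE.
Qed.

Lemma marked_iso_flip s t : marked_iso t s s t swap_mx.
Proof.
exists (@flip s t), (@flip t s), swap_mx; split.
- by split; exact: flipK.
- by split; apply/matrixP; apply: ord2_ind; apply: ord2_ind;
    rewrite !mxE !big_ord_recl big_ord0 !mxE /=; ring.
- exact: flip_affine.
- exact: flip_affine.
by move=> i; apply: filterS near0_usq => z h z0; rewrite flip_pt ?swap_mxE//; exact: h.
Qed.

Lemma marked_iso_shearT s t : marked_iso (t * s)%g t s t (shear_mx 1)^T.
Proof.
have -> : (shear_mx 1)^T = (swap_mx *m shear_mx 1) *m swap_mx.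
  by apply/matrixP; apply: ord2_ind; apply: ord2_ind;
    rewrite !mxE !big_ord_recl !big_ord0 !mxE !big_ord_recl !big_ord0 !mxE /=; ring.
have swap0 i j : 0 <= swap_mx i j.
  by move: i j; apply: ord2_ind; apply: ord2_ind; rewrite !mxE.
have shear0 i j : 0 <= shear_mx 1 i j.
  by move: i j; apply: ord2_ind; apply: ord2_ind; rewrite !mxE.
apply: marked_iso_comp (marked_iso_flip _ _) => //.
by apply: marked_iso_comp (marked_iso_shear _ _) => //; exact: marked_iso_flip.
Qed.

End Isomorphisms.

(** * Generation of the monoid SL_2^+(Z) by the two elementary matrices *)

Lemma det2 (A : 'M[int]_2) : \det A = A 0 0 * A 1 1 - A 0 1 * A 1 0.
Proof.
rewrite (expand_det_row _ 0) !big_ord_recl big_ord0 /cofactor !det_mx11 !mxE /=.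
have e1 : lift 0 0 = 1 :> 'I_2 by exact: val_inj.
have e0 : lift 1 0 = 0 :> 'I_2 by exact: val_inj.
by rewrite !e1 !e0 /= expr0 expr1; ring.
Qed.

Lemma mulmx_shear (A : 'M[int]_2) i j :
  (A *m shear_mx 1) i j = A i j + (if j == 1 then A i 0 else 0).
Proof.
rewrite mxE !big_ord_recl big_ord0 !mxE /= (_ : lift _ _ = 1); last exact: val_inj.
by move: j; apply: ord2_ind => /=; ring.
Qed.

Lemma mulmx_shearT (A : 'M[int]_2) i j :
  (A *m (shear_mx 1)^T) i j = A i j + (if j == 0 then A i 1 else 0).
Proof.
rewrite mxE !big_ord_recl big_ord0 !mxE /= (_ : lift _ _ = 1); last exact: val_inj.
by move: j; apply: ord2_ind => /=; ring.
Qed.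

(** Euclid's algorithm on columns: if one column dominates the other, subtracting the smaller one,
    nonzero since the determinant is 1, decreases the sum of the entries. *)
Lemma SL2plus_ind (P : 'M[int]_2 -> Prop) : P 1%:M ->
  (forall A, SL2plus A -> P A -> P (A *m shear_mx 1)) ->
  (forall A, SL2plus A -> P A -> P (A *m (shear_mx 1)^T)) ->
  forall A, SL2plus A -> P A.
Proof.
move=> P1 PU PL A [].
have [m] := ubnP (`|(A 0 0)%R| + `|(A 0 1)%R| + `|(A 1 0)%R| + `|(A 1 1)%R|)%N.
elim: m A => // m IH A hm; rewrite det2 => dA A0.
have h00 : (0 : int) <= A 0 0 := A0 0 0; have h01 : (0 : int) <= A 0 1 := A0 0 1.
have h10 : (0 : int) <= A 1 0 := A0 1 0; have h11 : (0 : int) <= A 1 1 := A0 1 1.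
pose U := \matrix_(i, j) (A i j - (if j == 1 then A i 0 else 0)) : 'M[int]_2.
pose L := \matrix_(i, j) (A i j - (if j == 0 then A i 1 else 0)) : 'M[int]_2.
have AU : A = U *m shear_mx 1.
  by apply/matrixP => i; apply: ord2_ind; rewrite mulmx_shear !mxE /=; ring.
have AL : A = L *m (shear_mx 1)^T.
  by apply/matrixP => i; apply: ord2_ind; rewrite mulmx_shearT !mxE /=; ring.
have dU : \det U = 1 by rewrite det2 !mxE /= -dA; ring.
have dL : \det L = 1 by rewrite det2 !mxE /= -dA; ring.
have [/andP[u0 u1]|hU] := boolP ((A 0 0 <= A 0 1) && (A 1 0 <= A 1 1)).
  have U0 i j : 0 <= U i j.
    by move: i j; apply: ord2_ind; apply: ord2_ind; rewrite !mxE /= ?subr0// subr_ge0.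
  have c0 : 0 < A 0 0 + A 1 0.
    rewrite lt_neqAle addr_ge0// andbT; apply/eqP => e; move: dA.
    have [-> ->] : A 0 0 = 0 /\ A 1 0 = 0 by lia.
    by rewrite mul0r mulr0.
  by rewrite AU; apply: PU => //; apply: IH => //; rewrite !mxE /=; lia.
have [/andP[l0 l1]|hL] := boolP ((A 0 1 <= A 0 0) && (A 1 1 <= A 1 0)).
  have L0 i j : 0 <= L i j.
    by move: i j; apply: ord2_ind; apply: ord2_ind; rewrite !mxE /= ?subr0// subr_ge0.
  have c0 : 0 < A 0 1 + A 1 1.
    rewrite lt_neqAle addr_ge0// andbT; apply/eqP => e; move: dA.
    have [-> ->] : A 0 1 = 0 /\ A 1 1 = 0 by lia.
    by rewrite mul0r mulr0.
  by rewrite AL; apply: PL => //; apply: IH => //; rewrite !mxE /=; lia.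
suff -> : A = 1%:M by [].
(* When no column dominates, the entries compare strictly in opposite ways in the two rows. With
   dominant diagonal the determinant is at least [1 + A 0 1 + A 1 0]; with dominant antidiagonal it
   is negative. *)
have [e0 e1] : A 0 1 = 0 /\ A 1 0 = 0 by nia.
by apply/matrixP; apply: ord2_ind; apply: ord2_ind; rewrite !mxE /=; nia.
Qed.

(** * Strips along saddle connections, and left codes *)

(** Connectedness of the unit interval: [P] and its negation are both open in it. *)
Lemma segment_ind {R : realType} (P : R -> Prop) : P 0 ->
  (forall u : R, 0 <= u <= 1 -> \forall u' \near u, 0 <= u' <= 1 -> P u <-> P u') ->
  P 1.
Proof.
move=> P0 hP.
have A01 (u : R) : `[0, 1]%classic u = (0 <= u <= 1) by rewrite /= in_itv.
suff e : `[0, 1]%classic `&` P = `[0, 1]%classic.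
  have : (`[0, 1]%classic `&` P) 1 by rewrite e A01 lexx ler01.
  by case.
apply: segment_connected.
- by exists 0; split=> //; rewrite A01 lexx ler01.
- exists (interior [set u : R | 0 <= u <= 1 -> P u]); first exact: open_interior.
  apply/seteqP; split=> u [Au].
    move=> Pu; split=> //; rewrite A01 in Au.
    by apply: filterS (hP u Au) => u' h /h [+ _]; apply.
  by move=> /interior_subset Pu; split=> //; apply: Pu; rewrite -A01.
- exists (~` interior [set u : R | 0 <= u <= 1 -> ~ P u]).
    exact/open_closedC/open_interior.
  apply/seteqP; split=> u [Au].
    move=> Pu; split=> // /interior_subset; apply => //; by rewrite -A01.
  move=> h; split=> //; apply: contrapT => nP; apply: h; rewrite A01 in Au.
  by apply: filterS (hP u Au) => u' h hu' Pu'; apply/nP/(h hu').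
Qed.

Lemma intr_itv01 {R : realType} (m : int) : ~ (0 < (m%:~R : R) < 1).
Proof. by rewrite ltr0z -[X in _ && (_ < X)]/(1%:~R) ltr_int => /andP[]; lia. Qed.

Lemma intr_approx {R : realType} (c : R) :
  (forall r : R, 0 < r -> exists2 a, `|a| < r & c - a \is a Num.int) ->
  c \is a Num.int.
Proof.
move=> h; apply: contrapT => hc.
pose f := c - (Num.floor c)%:~R.
have := floor_le c; have := floorD1_gt c; rewrite intrD => h1 h2.
have f0 : 0 < f.
  rewrite /f subr_gt0 lt_neqAle h2 andbT; apply/eqP => e; apply: hc.
  by rewrite -e intr_int.
have [|a] := h (Num.min f (1 - f)); first by rewrite lt_min f0 /f; lra.
rewrite lt_min !ltr_norml => /andP[a1 a2].
have -> : c - a = f - a + (Num.floor c)%:~R by rewrite /f; ring.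
move=> hi; have : f - a \is a Num.int.
  by rewrite -[f - a](addrK (Num.floor c)%:~R) rpredB// intr_int.
by move=> /intrP[m em]; apply: (@intr_itv01 R m); rewrite -em; lra.
Qed.

(** * Unique continuation of developments over convex sets *)

Section StepMaps.
Context {R : realType} {n : nat} {s t : 'S_n}.
Local Notation V := 'cV[R]_2.
Local Notation X := (surface R s t).

Implicit Types (D : set V) (h : V -> X).

(** Unlike for [local_translation], values may be zeros: the boundary line of a strip runs through
    them. *)
Definition step_map (D : set V) (h : V -> X) : Prop := forall z, D z ->
  \forall d \near (0 : V), D (z + d) -> step (h z) d (h (z + d)).

Definition convex_set2 (D : set V) : Prop := forall z z' (u : R),
  D z -> D z' -> 0 <= u <= 1 -> D (z + u *: (z' - z)).

Lemma local_translation_step_map D h : local_translation D h -> step_map D h.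
Proof.
move=> hh z /hh[_ /near_shiftP]; apply: filterS => d.
by rewrite addrAC subrr add0r.
Qed.

Lemma local_translationI D h : (forall z, D z -> regular (h z)) -> step_map D h ->
  local_translation D h.
Proof.
move=> hr hh z Dz; split; first exact: hr.
apply/near_shiftP; apply: filterS (hh z Dz) => d.
by rewrite addrAC subrr add0r.
Qed.

Lemma step_mapS (D D' : set V) h : D' `<=` D -> step_map D h -> step_map D' h.
Proof.
by move=> sD hh z /sD/hh; apply: filterS => d h1 /sD.
Qed.

Lemma step_map_within D h : step_map D h -> {within D, continuous h}.
Proof.
move=> hh; apply/subspace_continuousP => z Dz A /nbhs_step hA.
rewrite nbhs_simpl /=.
apply/(near_shiftP z (fun z => D z -> A (h z))).
by apply: filterS2 hA (hh z Dz) => d h1 h2 /h2/h1.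
Qed.

Lemma path_near (w : V) (P : V -> Prop) (u : R) :
  (\forall d \near (0 : V), P d) -> \forall u' \near u, P ((u' - u) *: w).
Proof.
move=> hP; suff : (fun u' : R => (u' - u) *: w) @ u --> (0 : V) by apply.
rewrite -[X in _ --> X](scale0r w) -(subrr u).
by apply: cvgZr_tmp => //; apply: cvgB => //; exact: cvg_cst.
Qed.

Lemma step_map_ind D (P : V -> Prop) : convex_set2 D ->
  (forall z, D z -> \forall d \near (0 : V), D (z + d) -> P z <-> P (z + d)) ->
  forall z z', D z -> D z' -> P z -> P z'.
Proof.
move=> cD hP z z' Dz Dz' Pz.
suff : P (z + 1 *: (z' - z)) by rewrite scale1r addrC subrK.
apply: (@segment_ind _ (fun u => P (z + u *: (z' - z)))).
  by rewrite scale0r addr0.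
move=> u hu; have Du := cD _ _ _ Dz Dz' hu.
apply: filterS (path_near (z' - z) u (hP _ Du)) => u' h1 hu'.
rewrite (_ : z + u' *: (z' - z) = z + u *: (z' - z) + (u' - u) *: (z' - z)).
  apply: h1; rewrite -addrA -scalerDl addrC [u + _]addrC subrK addrC; exact: cD.
by rewrite -addrA -scalerDl [u + _]addrC subrK.
Qed.

Lemma step_map_tor D h : convex_set2 D -> step_map D h -> forall z z', D z -> D z' ->
  forall c, intv (tor (h z) - z - c) -> intv (tor (h z') - z' - c).
Proof.
move=> cD hh z z' Dz Dz' c.
apply: (step_map_ind (P := fun z => intv (tor (h z) - z - c)) cD _ Dz Dz').
move=> {}z {}Dz; apply: filterS (hh z Dz) => d hd Dzd.
have hi := tor_step (hd Dzd); split=> h1.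
  rewrite (_ : _ - c = (tor (h z) - z - c) + (tor (h (z + d)) - tor (h z) - d)).
    exact: intvD.
  by apply/colP => k; rewrite !mxE; ring.
rewrite (_ : _ - c = (tor (h (z + d)) - (z + d) - c) - (tor (h (z + d)) - tor (h z) - d)).
  by apply: intvD => //; exact: intvN.
by apply/colP => k; rewrite !mxE; ring.
Qed.

(** Agreement propagates forward by [step_unique], since the values of [h] are regular, and backward
    by [step_inj_src], valid at every point. *)
Lemma step_map_eq D h h' : convex_set2 D -> step_map D h -> step_map D h' ->
  (forall z, D z -> regular (h z)) -> forall z z', D z -> D z' ->
  h z = h' z -> h z' = h' z'.
Proof.
move=> cD hh hh' hr z z' Dz Dz'.
apply: (step_map_ind (P := fun z => h z = h' z) cD _ Dz Dz').
move=> {}z {}Dz; apply: filterS3 (hh z Dz) (hh' z Dz) (near_near_point (h z)).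
move=> d h1 h2 h3 Dzd; split=> e.
  by apply: step_unique (h1 Dzd) _; [exact: hr|rewrite e; exact: h2].
by apply: step_inj_src h3 (h1 Dzd) _; rewrite e; exact: h2.
Qed.

Lemma tor_star D h z x : convex_set2 D -> step_map D h -> D z ->
  intv (tor x - z) -> h z = x -> forall z', D z' -> intv (tor (h z') - z').
Proof.
move=> cD hh Dz hx ex z' Dz'; have := step_map_tor cD hh Dz Dz' (c := 0).
by rewrite !subr0 ex; apply.
Qed.

Lemma interior_regular (x : X) i p k : unit_square R p -> x = pt i p ->
  0 < p k 0 < 1 -> regular x.
Proof.
move=> hp ex hk j j' q hq ej ej'; apply: (@pt_inj_edge _ _ s t k _ _ q) => //.
  have := pt_intv hp hq (etrans (esym ex) ej) k; rewrite !mxE => /intrP[m em].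
  have hqk := hq k.
  have [m1 m2] : (m < 1) /\ (-1 < m).
    by split; rewrite -(ltr_int R) -em ?mulrN1z; lra.
  have m0 : m = 0 by lia.
  by move: em; rewrite m0 => /eqP; rewrite subr_eq0 => /eqP ->.
by rewrite -ej.
Qed.

End StepMaps.

Section Cross.
Context {R : realType}.
Local Notation V := 'cV[R]_2.

Definition cross (a b : V) : R := a 0 0 * b 1 0 - a 1 0 * b 0 0.

Lemma crossD a b c : cross a (b + c) = cross a b + cross a c.
Proof. by rewrite /cross !mxE; ring. Qed.

Lemma crossN a b : cross a (- b) = - cross a b.
Proof. by rewrite /cross !mxE; ring. Qed.

Lemma crossZ a u b : cross a (u *: b) = u * cross a b.
Proof. by rewrite /cross !mxE; ring. Qed.

Lemma crossvv a : cross a a = 0.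
Proof. by rewrite /cross; ring. Qed.

Lemma cross_mulmx (B : 'M[R]_2) a b :
  cross (B *m a) (B *m b) = (B 0 0 * B 1 1 - B 0 1 * B 1 0) * cross a b.
Proof. by rewrite /cross !mulmx2E; ring. Qed.

(** This is the origin of the height 1 of [slab]: integer vectors lie on the lines where the cross
    product is an integer. *)
Lemma cross_int (v : 'cV[int]_2) (c : V) : intv c -> cross (dir v) c \is a Num.int.
Proof.
by move=> hc; rewrite /cross !mxE rpredB// rpredM// ?intr_int//; exact: hc.
Qed.

Lemma near_cross a (r : R) : 0 < r -> \forall d \near (0 : V), `|cross a d| < r.
Proof.
move=> r0; pose M := 1 + (`|a 0 0| + `|a 1 0|).
have a00 := normr_ge0 (a 0 0); have a10 := normr_ge0 (a 1 0).
have M0 : 0 < M by rewrite /M; lra.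
apply/near_vecP; exists (r / M); first by rewrite divr_gt0.
move=> d hd; have := hd 0; have := hd 1; rewrite !mxE !subr0 !ltr_pdivlMr// => h1 h0.
apply: le_lt_trans (ler_normB _ _) _; rewrite !normrM.
have d0 := normr_ge0 (d 0 0); have d1 := normr_ge0 (d 1 0).
by have [hle|hle] := leP `|d 0 0| `|d 1 0|; rewrite /M in h0 h1; nra.
Qed.

Definition sqnorm (v : 'cV[int]_2) : R := (v 0 0)%:~R ^+ 2 + (v 1 0)%:~R ^+ 2.

Lemma sqnorm_gt0 v : v != 0 -> 0 < sqnorm v.
Proof.
move=> v0; rewrite lt_neqAle addr_ge0 ?sqr_ge0// andbT eq_sym.
rewrite paddr_eq0 ?sqr_ge0// !sqrf_eq0 !intr_eq0; apply: contra v0 => /andP[/eqP a /eqP b].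
by apply/eqP; apply: vec2_eq; rewrite mxE.
Qed.

Lemma cross_leftpt v (u w : R) : cross (dir v) (leftpt v u w) = w * sqnorm v.
Proof. by rewrite /cross /leftpt /sqnorm !mxE /=; ring. Qed.

Lemma leftpt0 v (u : R) : leftpt v u 0 = u *: dir v.
Proof. by rewrite /leftpt scale0r addr0. Qed.

Lemma dir_eq0 v : v != 0 -> dir v != 0 :> V.
Proof.
apply: contra => /eqP e; apply/eqP/vec2_eq; have := congr1 (fun p : V => p 0 0) e;
  have := congr1 (fun p : V => p 1 0) e; rewrite !mxE => /eqP; rewrite intr_eq0 => /eqP h1;
  by move=> /eqP; rewrite intr_eq0 => /eqP h0.
Qed.

End Cross.

Lemma conv_itv {R : realType} (a b u lo hi : R) : 0 <= u <= 1 ->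
  (lo <= a < hi -> lo <= b < hi -> lo <= a + u * (b - a) < hi) /\
  (lo < a < hi -> lo < b < hi -> lo < a + u * (b - a) < hi).
Proof.
move=> /andP[u0 u1].
have h : Num.min a b <= a + u * (b - a) <= Num.max a b.
  have [ab|/ltW ab] := leP a b.
    have h1 : 0 <= u * (b - a) by rewrite mulr_ge0// subr_ge0.
    have h2 : 0 <= (1 - u) * (b - a) by rewrite mulr_ge0// subr_ge0.
    lra.
  have h1 : 0 <= u * (a - b) by rewrite mulr_ge0// subr_ge0.
  have h2 : 0 <= (1 - u) * (a - b) by rewrite mulr_ge0// subr_ge0.
  lra.
split=> /andP[a0 a1] /andP[b0 b1]; case/andP: h => h1 h2; apply/andP; split.
- by apply: le_trans h1; rewrite le_min a0.
- by apply: le_lt_trans h2 _; rewrite gt_max a1.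
- by apply: lt_le_trans h1; rewrite lt_min a0.
- by apply: le_lt_trans h2 _; rewrite gt_max a1.
Qed.

(** * Strips give left boundaries and their successors *)

Section Strips.
Context {R : realType} {n : nat} {s t : 'S_n}.
Local Notation V := 'cV[R]_2.
Local Notation X := (surface R s t).
Local Notation usq := (unit_square R).
Implicit Types (v : 'cV[int]_2) (H g h : V -> X) (i k : 'I_n).

(* Strips are bi-infinite because affine maps do not preserve rectangles: a slanted
   image of [0, 2] x [0, e) contains no rectangle with the same base. *)
Definition slab v : set V := [set z | 0 <= cross (dir v) z < 1].

(** [H] develops the left side of the whole line prolonging gamma_i. The points [m%:~R *: dir v],
    where successive saddle connections meet, are exempted from regularity, as zeros may sit
    there. *)
Definition strip v i H : Prop :=
  [/\ step_map (slab v) H,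
      forall z, slab v z ->
        0 < cross (dir v) z \/ (forall m : int, z <> m%:~R *: dir v) -> regular (H z)
    & exists2 e : R, 0 < e &
        forall u, 0 <= u < e -> H (u *: dir v) = pt i (u *: dir v)].

Lemma slab_line v u : slab v (u *: dir v).
Proof. by rewrite /slab /= crossZ crossvv mulr0 lexx ltr01. Qed.

Lemma convex_slab v : convex_set2 (slab v).
Proof.
move=> z z' u; rewrite /slab /= !(crossD, crossZ, crossN).
by move=> hz hz' hu; apply: (conv_itv _ _ _ _ hu).1.
Qed.

Lemma near0_ray (w : V) (P : V -> Prop) : (\forall d \near (0 : V), P d) ->
  exists2 e : R, 0 < e & forall u, 0 <= u < e -> P (u *: w).
Proof.
move=> hP; have := path_near w 0 hP.
move=> /nbhs_ballP[e e0 he]; exists e => // u hu.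
case/andP: hu => u0 ue; have := he u; rewrite subr0; apply.
by rewrite /ball /= sub0r normrN ger0_norm.
Qed.

Lemma small_dir_usq v : (forall l, 0 <= v l 0) ->
  exists2 e : R, 0 < e & forall u, 0 <= u < e -> usq (u *: dir v).
Proof.
move=> v0; have [e e0 he] := near0_ray (dir v) (@near0_usq R).
exists e => // u hu; apply: he => // k; rewrite !mxE mulr_ge0//; first by case/andP: hu.
by rewrite ler0z.
Qed.

Lemma open_line_convex v : convex_set2 [set (u : R) *: dir v | u in `]0, 1[%classic].
Proof.
move=> _ _ u [a + <-] [b + <-]; rewrite /= !in_itv /= => ha hb hu.
exists (a + u * (b - a)); last by rewrite -scalerBl scalerA -scalerDl.
by rewrite /= in_itv /=; exact: (conv_itv _ _ _ _ hu).2.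
Qed.

Lemma saddle_tor v i g : (forall l, 0 <= v l 0) -> saddle v i g ->
  forall u, 0 < u < 1 -> intv (tor (g (u *: dir v)) - u *: dir v).
Proof.
move=> v0 [_ /translation_mapE/local_translation_step_map hg [e e0 he]] u hu.
have [e' e'0 he'] := small_dir_usq v0.
pose u0 := Num.min (1 / 2) (Num.min e e' / 2).
have [u00 u01 u0e u0e'] : [/\ 0 < u0, u0 < 1, u0 < e & u0 < e'].
  have m0 : 0 < Num.min e e' by rewrite lt_min e0.
  have me : Num.min e e' <= e by rewrite ge_min lexx.
  have me' : Num.min e e' <= e' by rewrite ge_min lexx orbT.
  have a1 : u0 <= 1 / 2 by rewrite /u0 ge_min lexx.
  have a2 : u0 <= Num.min e e' / 2 by rewrite /u0 ge_min lexx orbT.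
  by split; [rewrite /u0 lt_min; lra|lra|lra|lra].
apply: (tor_star (@open_line_convex v) hg (z := u0 *: dir v) (x := pt i (u0 *: dir v))).
- by exists u0 => //; rewrite /= in_itv /= u00.
- by apply: (tor_pt _ (erefl _)); apply: he'; rewrite u0e' ltW.
- by rewrite he// u0e ltW.
- by exists u => //; rewrite /= in_itv.
Qed.

Lemma strip_tor v i H : strip v i H -> forall z, slab v z -> intv (tor (H z) - z).
Proof.
move=> [hH _ [e e0 he]] z hz.
have z0 : slab v 0 by rewrite -(scale0r (dir v)); exact: slab_line.
apply: (tor_star (@convex_slab v) hH z0 (x := pt i 0)) => //.
  by apply: (tor_pt _ (erefl _)) => k; rewrite mxE lexx ler01.
by rewrite -(scale0r (dir v)) he// lexx.
Qed.

Lemma strip_saddle v i H : v != 0 -> strip v i H -> saddle v i H.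
Proof.
move=> v0 [hH hr he]; split=> //.
  apply: step_map_within; apply: step_mapS hH => _ [u _ <-]; exact: slab_line.
apply/translation_mapE/local_translationI => [_ [u + <-]|].
  rewrite /= in_itv /= => hu; apply: hr; first exact: slab_line.
  right=> m /eqP; rewrite -subr_eq0 -scalerBl scaler_eq0 (negbTE (dir_eq0 v0)) orbF.
  rewrite subr_eq0 => /eqP um.
  by apply: (@intr_itv01 R m); rewrite -um.
by apply: step_mapS hH => _ [u _ <-]; exact: slab_line.
Qed.

(** Modulo integer vectors a saddle connection lies on the line of [dir v], whereas the cross
    product of [z] is strictly between two consecutive integers. *)
Lemma strip_not_saddle v i H z : (forall l, 0 <= v l 0) -> strip v i H ->
  0 < cross (dir v) z < 1 -> ~ saddle_union v (H z).
Proof.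
move=> v0 hH hz [j [g [u [hg hu e]]]].
have sz : slab v z by rewrite /slab /=; lra.
pose r := Num.min (cross (dir v) z) (1 - cross (dir v) z).
have r0 : 0 < r by rewrite /r lt_min; lra.
have [cg _ _] := hg.
move/subspace_continuousP : cg => /(_ (u *: dir v)).
have Du : [set u *: dir v | u in `[0, 1]%classic] (u *: dir v).
  by exists u => //; rewrite /= in_itv.
move=> /(_ Du) cg.
have : \forall y \near g (u *: dir v), exists2 d, `|cross (dir v) d| < r & step (H z) d y.
  by rewrite -e; apply: near_exists_step; exact: near_cross.
move=> /cg; rewrite nbhs_simpl /= => hn.
have [u' hu' [d hd hs]] : exists2 u', 0 < u' < 1 &
    exists2 d, `|cross (dir v) d| < r & step (H z) d (g (u' *: dir v)).
  move/(near_shiftP (u *: dir v)) : hn => /(path_near (dir v) u)/nbhs_ballP[a a0 ha].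
  (* At its ends a saddle connection is only known to be continuous, so [u] is first moved by [b]
     into the open segment. *)
  pose b := Num.min (a / 2) (1 / 4).
  have [b0 ba b4] : [/\ 0 < b, b < a & b <= 1 / 4].
    have h1 : b <= a / 2 by rewrite /b ge_min lexx.
    have h2 : b <= 1 / 4 by rewrite /b ge_min lexx orbT.
    have h0 : 0 < a := a0.
    by split=> //; [rewrite /b lt_min; lra|lra].
  have [u' hu' hb] : exists2 u' : R, 0 < u' < 1 & `|u' - u| <= b.
    have [h|h] := leP u (1 / 2).
      by exists (u + b); [lra|rewrite addrAC subrr add0r gtr0_norm].
    by exists (u - b); [lra|rewrite addrAC subrr add0r normrN gtr0_norm].
  exists u' => //; have := ha u'; rewrite /= -scalerDl [u + _]addrC subrK; apply.
    by rewrite /ball /= distrC; exact: le_lt_trans ba.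
  by exists u' => //; rewrite /= in_itv /=; lra.
have h1 := saddle_tor v0 hg hu'; have h2 := tor_step hs; have h3 := strip_tor hH sz.
have : intv (z + d - u' *: dir v).
  rewrite (_ : _ - _ = (tor (g (u' *: dir v)) - u' *: dir v) -
     (tor (g (u' *: dir v)) - tor (H z) - d) - (tor (H z) - z)).
    by apply: intvD; [apply: intvD => //|]; exact: intvN.
  by apply/colP => k; rewrite !mxE; ring.
move=> /(cross_int v); rewrite !(crossD, crossN, crossZ) crossvv mulr0 subr0.
move=> /intrP[m em]; move: hd; rewrite lt_min !ltr_norml => hd.
by apply: (@intr_itv01 R m); rewrite -em; lra.
Qed.

Lemma strip_component v i H z z' : (forall l, 0 <= v l 0) -> strip v i H ->
  0 < cross (dir v) z < 1 -> 0 < cross (dir v) z' < 1 ->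
  connected_component (~` saddle_union v) (H z) (H z').
Proof.
move=> v0 hH hz hz'.
pose p (u : R) := z + u *: (z' - z).
have hp u : 0 <= u <= 1 -> 0 < cross (dir v) (p u) < 1.
  by rewrite /p !(crossD, crossZ, crossN) => hu; exact: (conv_itv _ _ _ _ hu).2.
apply: (@connected_component_max _ _ ((H \o p) @` `[0, 1]%classic)).
- by exists 0; rewrite /= ?in_itv /= ?lexx ?ler01// /p scale0r addr0.
- by move=> _ [u + <-]; rewrite /= in_itv /= => /hp hpu; apply: (strip_not_saddle v0 hH hpu).
- apply: connected_continuous_connected; first exact: segment_connected.
  apply/subspace_continuousP => u; rewrite /= in_itv /= => hu A /nbhs_step hA.
  rewrite nbhs_simpl /=.
  have sl w : 0 <= w <= 1 -> slab v (p w) by move=> /hp; rewrite /slab /=; lra.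
  have [hs _ _] := hH.
  have h1 : \forall d \near (0 : V), (forall y, step (H (p u)) d y -> A y) /\
      (slab v (p u + d) -> step (H (p u)) d (H (p u + d))).
    by apply: filterI; [exact: hA|exact: hs (sl u hu)].
  have := path_near (z' - z) u h1; rewrite /within /=.
  apply: filterS => w [h2 h3] hw.
  have e : p u + (w - u) *: (z' - z) = p w.
    by rewrite /p -addrA -scalerDl [u + _]addrC subrK.
  by rewrite e in h3; apply: h2; apply: h3; apply: sl; rewrite in_itv in hw.
by exists 1; rewrite /= ?in_itv /= ?lexx ?ler01// /p scale1r addrC subrK.
Qed.

(** The same [H] serves as collar of gamma_i and as strip over both saddle connections. In the
    coordinates of [leftpt] the slab has height [q^-1], because turning [dir v] by a right angle
    gives cross product [q]. *)
Lemma strip_next v i k H : v != 0 -> (forall l, 0 <= v l 0) ->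
  strip v i H -> strip v k (fun z => H (dir v + z)) ->
  exists C : set X, [/\ cylinder v C, left_boundary v C i & next_left_boundary v C i k].
Proof.
move=> v0 vp hi hk; have q0 := @sqnorm_gt0 R v v0; set q := sqnorm v in q0.
have hq (u w : R) : 0 < w < q^-1 -> 0 < cross (dir v) (leftpt v u w) < 1.
  move=> /andP[w0 w1]; rewrite cross_leftpt -/q mulr_gt0//=.
  by rewrite -(mulVf (lt0r_neq0 q0)) ltr_pM2r.
have hq0 (u w : R) : 0 <= w < q^-1 -> slab v (leftpt v u w).
  move=> /andP[w0 w1]; rewrite /slab /= cross_leftpt -/q mulr_ge0// ?ltW//=.
  by rewrite -(mulVf (lt0r_neq0 q0)) ltr_pM2r.
pose z0 := leftpt v 0 (q^-1 / 2).
have hz0 : 0 < cross (dir v) z0 < 1.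
  by apply: hq; have : 0 < q^-1; [rewrite invr_gt0|lra].
have hC u w : 0 < w < q^-1 ->
    connected_component (~` saddle_union v) (H z0) (H (leftpt v u w)).
  by move=> hw; apply: strip_component vp hi hz0 _; exact: hq.
have [hs hr _] := hi.
exists (connected_component (~` saddle_union v) (H z0)); split.
- by exists (H z0) => //; exact: (strip_not_saddle vp hi hz0).
- exists H, H, q^-1; split=> //.
  + exact: strip_saddle.
  + by rewrite invr_gt0.
  + apply/translation_mapE/local_translationI; last first.
      by apply: step_mapS hs => _ [u [w [_ hw ->]]]; exact: hq0.
    move=> _ [u [w [hu hw ->]]]; apply: hr; first exact: hq0.
    have [->|w0] := eqVneq w 0; last first.
      by left; have /(hq u)/andP[] : 0 < w < q^-1 by rewrite lt_neqAle eq_sym w0.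
    right=> m; rewrite leftpt0 => /eqP.
    rewrite -subr_eq0 -scalerBl scaler_eq0 (negbTE (dir_eq0 v0)) orbF.
    rewrite subr_eq0 => /eqP um.
  by apply: (@intr_itv01 R m); rewrite -um.
  + by move=> u w _; exact: hC.
exists H, (fun z => H (dir v + z)), H, q^-1; split; split.
- exact: strip_saddle.
- exact: strip_saddle.
- by rewrite invr_gt0.
- apply: step_map_within; apply: step_mapS hs => _ [u [w [_ hw ->]]]; exact: hq0.
- apply/translation_mapE/local_translationI; last first.
    by apply: step_mapS hs => _ [u [w [_ hw ->]]]; apply: hq0; lra.
  move=> _ [u [w [hu hw ->]]]; apply: hr; first by apply: hq0; lra.
  by left; case/andP: (hq u w hw).
- by move=> u w _; exact: hC.
- by [].
- by move=> u _; rewrite scalerDl scale1r.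
Qed.

End Strips.

(** * Uniqueness of the successor of a left boundary *)

Section StripUniqueness.
Context {R : realType} {n : nat} {s t : 'S_n}.
Local Notation V := 'cV[R]_2.
Local Notation X := (surface R s t).
Local Notation usq := (unit_square R).
Implicit Types (v : 'cV[int]_2) (H g h : V -> X) (i k : 'I_n).

Definition open_strip v (e : R) : set V :=
  [set z | exists u w : R, [/\ 0 < u < 2, 0 < w < e & z = leftpt v u w]].

Definition closed_strip v (e : R) : set V :=
  [set z | exists u w : R, [/\ 0 <= u <= 2, 0 <= w < e & z = leftpt v u w]].

Lemma convex_open_strip v e : convex_set2 (open_strip v e).
Proof.
move=> _ _ u [a [b [ha hb ->]]] [a' [b' [ha' hb' ->]]] hu.
exists (a + u * (a' - a)), (b + u * (b' - b)); split.
- exact: (conv_itv _ _ _ _ hu).2.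
- exact: (conv_itv _ _ _ _ hu).2.
- by rewrite /leftpt; apply/colP => l; rewrite !mxE; ring.
Qed.

Lemma open_strip_near v e (a : R) (P : V -> Prop) : 0 < e -> 0 < a < 2 ->
  (\forall z \near a *: dir v, P z) -> exists2 z, open_strip v e z & P z.
Proof.
move=> e0 ha /near_shiftP/(near0_ray (rot90 (dir v)))[r r0 hr].
pose w := Num.min e r / 2.
have m0 : 0 < Num.min e r by rewrite lt_min e0.
have me : Num.min e r <= e by rewrite ge_min lexx.
have mr : Num.min e r <= r by rewrite ge_min lexx orbT.
exists (leftpt v a w); first by exists a, w; split=> //; rewrite /w; lra.
by apply: hr; rewrite /w; lra.
Qed.

Lemma within_step (D : set V) h z0 (e : R) : {within D, continuous h} -> D z0 -> 0 < e ->
  \forall z \near z0, D z -> exists2 d : V, (forall l, `|d l 0| < e) & step (h z0) d (h z).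
Proof.
move=> /subspace_continuousP ch Dz0 e0.
have : \forall y \near h z0, exists2 d : V, (forall l, `|d l 0| < e) & step (h z0) d y.
  apply: near_exists_step; apply/near_vecP; exists e => // d hd l.
  by have := hd l; rewrite mxE subr0.
by move=> /(ch z0 Dz0); rewrite nbhs_simpl.
Qed.

Lemma near_small (z0 : V) (e : R) : 0 < e ->
  \forall z \near z0, forall l, `|(z - z0) l 0| < e.
Proof. by move=> e0; apply/near_vecP; exists e => // d hd l; rewrite !mxE; exact: hd. Qed.

(** On the boundary only continuity is available: it provides some short displacement from [h z0] to
    [h z], and the comparison in the torus forces it to be [z - z0]. *)
Lemma boundary_step (D D' : set V) h z0 : {within D', continuous h} -> D' z0 ->
  D `<=` D' -> intv (tor (h z0) - z0) -> (forall z, D z -> intv (tor (h z) - z)) ->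
  \forall z \near z0, D z -> step (h z0) (z - z0) (h z).
Proof.
move=> ch Dz0 sD h0 hD; have e2 : 0 < (2^-1 : R) by rewrite invr_gt0.
apply: filterS2 (within_step ch Dz0 e2) (near_small z0 e2) => z hz hzs Dz.
have [d hd hs] := hz (sD _ Dz).
suff -> : z - z0 = d by [].
apply/eqP; rewrite -subr_eq0; apply/eqP/intv_small => [|l]; last first.
  rewrite mxE [(- d) l 0]mxE; apply: le_lt_trans (ler_normB _ _) _.
  by have := hd l; have := hzs l; lra.
rewrite (_ : _ - d = (tor (h z) - tor (h z0) - d) + (tor (h z0) - z0) - (tor (h z) - z)).
  by apply: intvD; [apply: intvD => //; exact: tor_step|apply: intvN; exact: hD].
by apply/colP => l; rewrite !mxE; ring.
Qed.

(** The position modulo integers is constant on the open strip; continuity approximates it by the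
    one at the boundary point, and the integers are closed ([intr_approx]). *)
Lemma open_strip_tor v e h (a : R) : 0 < e -> 0 < a < 2 ->
  {within closed_strip v e, continuous h} -> step_map (open_strip v e) h ->
  intv (tor (h (a *: dir v)) - a *: dir v) ->
  forall z, open_strip v e z -> intv (tor (h z) - z).
Proof.
move=> e0 ha ch hh h0 z1 Dz1 l; set z0 := a *: dir v in h0 *.
have Dz0 : closed_strip v e z0.
  by exists a, 0; split; [lra|rewrite lexx|rewrite leftpt0].
apply: intr_approx => r r0; have r2 : 0 < r / 2 by rewrite divr_gt0.
have [z Dz [hz hzs]] : exists2 z, open_strip v e z &
    (closed_strip v e z ->
      exists2 d : V, (forall l, `|d l 0| < r / 2) & step (h z0) d (h z)) /\
    (forall l, `|(z - z0) l 0| < r / 2).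
  apply: (open_strip_near e0 ha); apply: filterI; last exact: near_small.
  exact: within_step.
have [|d hd hs] := hz.
  by have [u [w [hu hw ->]]] := Dz; exists u, w; split=> //; lra.
exists ((d - (z - z0)) l 0).
  rewrite mxE [(- (z - z0)) l 0]mxE; apply: le_lt_trans (ler_normB _ _) _.
  by have := hd l; have := hzs l; lra.
have h1 := @step_map_tor _ _ _ _ _ _ (@convex_open_strip v e) hh _ _ Dz Dz1 (tor (h z) - z).
have : intv (tor (h z1) - z1 - (d - (z - z0))).
  rewrite (_ : _ - (d - _) = (tor (h z1) - z1 - (tor (h z) - z)) +
    (tor (h z) - tor (h z0) - d) + (tor (h z0) - z0)).
    apply: intvD => //; apply: intvD; last exact: tor_step.
    by apply: h1; rewrite subrr; exact: intv0.
  by apply/colP => l'; rewrite !mxE; ring.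
by move=> /(_ l); rewrite [X in X \is a _ -> _]mxE [(- (d - _)) l 0]mxE.
Qed.

(** Just after its beginning a saddle connection is away from the corners, so [pt_inj_edge] can read
    its label there. *)
Lemma small_dir_edge v : v != 0 -> (forall l, 0 <= v l 0) -> exists2 e : R, 0 < e &
  forall u, 0 < u < e -> usq (u *: dir v) /\ exists l, 0 < (u *: dir v) l 0 < 1.
Proof.
move=> v0 vp; have [e e0 he] := @small_dir_usq R v vp.
exists (e / 2); first by rewrite divr_gt0.
move=> u hu; split; first by apply: he; lra.
have [l hl] : exists l, 0 < v l 0.
  apply: contrapT => h; move/eqP: v0; apply; apply/colP => l; rewrite mxE.
  apply/eqP; rewrite eq_le vp andbT leNgt; apply/negP => hl; apply: h; by exists l.
exists l; rewrite !mxE; have h1 : 0 < ((v l 0)%:~R : R) by rewrite ltr0z.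
apply/andP; split; first by rewrite mulr_gt0//; case/andP: hu.
(* Since the double of the vector is still in the square, its coordinate is at most 1/2. *)
have := he (2 * u); rewrite /unit_square /= => /(_ _ l); rewrite !mxE => h2.
have {}h2 : 0 <= 2 * u * (v l 0)%:~R <= 1 by apply: h2; lra.
have h3 : 0 < u * (v l 0)%:~R by rewrite mulr_gt0//; case/andP: hu.
lra.
Qed.

(* Two developments of the strip which agree near the beginning of gamma_i agree up
   to the beginning of the next saddle connection, where the label is read off. *)
Lemma strip_unique v i k k' H (C : set X) : v != 0 -> (forall l, 0 <= v l 0) ->
  strip v i H -> strip v k (fun z => H (dir v + z)) ->
  next_left_boundary v C i k' -> k' = k.
Proof.
move=> v0 vp hi hk [gi [gk [h [e [[hgi hgk e0] [ch hh _ h1 h2]]]]]].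
have q0 := @sqnorm_gt0 R v v0; set q := sqnorm v in q0.
have qi : 0 < q^-1 by rewrite invr_gt0.
pose e' := Num.min e q^-1.
have e'0 : 0 < e' by rewrite /e' lt_min e0.
have e'e : e' <= e by rewrite /e' ge_min lexx.
have e'q : e' <= q^-1 by rewrite /e' ge_min lexx orbT.
have ch' : {within closed_strip v e', continuous h}.
  apply: continuous_subspaceW ch => _ [u [w [hu hw ->]]].
  by exists u, w; split=> //; lra.
have hD : step_map (open_strip v e') h /\ forall z, open_strip v e' z -> regular (h z).
  have sD : open_strip v e' `<=` open_strip v e.
    by move=> _ [u [w [hu hw ->]]]; exists u, w; split=> //; lra.
  move/translation_mapE in hh; split.
    by apply: step_mapS sD _; exact: local_translation_step_map.
  by move=> z /sD /hh[].
have [hs hr [ei ei0 hei]] := hi; have [_ _ [ek ek0 hek]] := hk.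
have [_ _ [ei' ei'0 hei']] := hgi; have [_ _ [ek' ek'0 hek']] := hgk.
have sS : open_strip v e' `<=` slab v.
  move=> _ [u [w [_ /andP[w0 w1] ->]]]; rewrite /slab /= cross_leftpt -/q.
  rewrite mulr_ge0 ?ltW//= -(mulVf (lt0r_neq0 q0)) ltr_pM2r//.
  exact: lt_le_trans w1 e'q.
have sC : open_strip v e' `<=` closed_strip v e'.
  by move=> _ [u [w [hu hw ->]]]; exists u, w; split=> //; lra.
have Cz a : 0 <= a <= 2 -> closed_strip v e' (a *: dir v).
  by move=> ha; exists a, 0; split; rewrite ?lexx ?leftpt0.
have HD : step_map (open_strip v e') H by exact: step_mapS hs.
have [u0 [u00 u01 u0i u0i']] : exists u0 : R, [/\ 0 < u0, u0 < 1, u0 < ei & u0 < ei'].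
  exists (Num.min 1 (Num.min ei ei') / 2).
  have m0 : 0 < Num.min 1 (Num.min ei ei') by rewrite !lt_min ei0 ei'0 ltr01.
  have m1 : Num.min 1 (Num.min ei ei') <= 1 by rewrite ge_min lexx.
  have m2 : Num.min 1 (Num.min ei ei') <= ei by rewrite !ge_min lexx orbT.
  have m3 : Num.min 1 (Num.min ei ei') <= ei' by rewrite !ge_min lexx !orbT.
  by split; lra.
have [eu eu0 heu] := @small_dir_edge v v0 vp.
have [u1 [u10 u11 u1k [u1k' u1u]]] : exists u1 : R,
    [/\ 0 < u1, u1 < 1, u1 < ek & u1 < ek' /\ u1 < eu].
  exists (Num.min (Num.min 1 eu) (Num.min ek ek') / 2).
  have m0 : 0 < Num.min (Num.min 1 eu) (Num.min ek ek').
    by rewrite !lt_min ek0 ek'0 eu0 ltr01.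
  have m1 : Num.min (Num.min 1 eu) (Num.min ek ek') <= 1 by rewrite !ge_min lexx.
  have m2 : Num.min (Num.min 1 eu) (Num.min ek ek') <= eu by rewrite !ge_min lexx !orbT.
  have m3 : Num.min (Num.min 1 eu) (Num.min ek ek') <= ek by rewrite !ge_min lexx !orbT.
  have m4 : Num.min (Num.min 1 eu) (Num.min ek ek') <= ek' by rewrite !ge_min lexx !orbT.
  by split; lra.
pose z0 : V := u0 *: dir v; pose z1 : V := (1 + u1) *: dir v.
have hz0 : h z0 = H z0.
  by rewrite /z0 h1 ?hei ?hei' ?u0i ?u0i' ?(ltW u00) ?(ltW u01).
have hz1 : h z1 = pt k' (u1 *: dir v).
  by rewrite /z1 h2 ?hek' ?u1k' ?(ltW u10) ?(ltW u11).
have Hz1 : H z1 = pt k (u1 *: dir v).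
  by rewrite /z1 scalerDl scale1r hek// u1k ltW.
have [us1 [l hl]] : usq (u1 *: dir v) /\ exists l, 0 < (u1 *: dir v : V) l 0 < 1.
  by apply: heu; rewrite u10.
have t0 : intv (tor (h z0) - z0) by rewrite hz0; apply: (strip_tor hi); exact: slab_line.
have t1 : intv (tor (h z1) - z1).
  rewrite (_ : _ - z1 = (tor (h z1) - u1 *: dir v) - dir v).
    apply: intvD; first exact: (tor_pt us1 hz1).
    by apply: intvN => l'; rewrite mxE intr_int.
  by apply/colP => l'; rewrite !mxE; ring.
have tD : forall z, open_strip v e' z -> intv (tor (h z) - z).
  by apply: (open_strip_tor e'0 _ ch' hD.1 t0); lra.
have b0 : \forall z \near z0, open_strip v e' z -> step (h z0) (z - z0) (h z).
  by apply: (boundary_step ch' (Cz _ _) sC t0 tD); lra.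
have b1 : \forall z \near z1, open_strip v e' z -> step (h z1) (z - z1) (h z).
  by apply: (boundary_step ch' (Cz _ _) sC t1 tD); lra.
have HS a : \forall z \near a *: dir v, open_strip v e' z ->
    step (H (a *: dir v)) (z - a *: dir v) (H z).
  apply/near_shiftP; apply: filterS (hs _ (slab_line v a)) => d + Dd.
  by rewrite addrAC subrr add0r; apply; exact: sS.
(* [z0] lies inside gamma_i, hence is sent to a regular point, from which both developments enter
   the open strip at the same point. *)
have rz0 : regular (h z0).
  rewrite hz0; apply: hr; first exact: slab_line.
  right=> m /eqP; rewrite -subr_eq0 -scalerBl scaler_eq0 (negbTE (dir_eq0 v0)) orbF.
  rewrite subr_eq0 => /eqP um.
  by apply: (@intr_itv01 R m); rewrite -um u00.
have [z Dz [hz Hz]] : exists2 z, open_strip v e' z &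
    (open_strip v e' z -> step (h z0) (z - z0) (h z)) /\
    (open_strip v e' z -> step (H z0) (z - z0) (H z)).
  by apply: (open_strip_near e'0) (filterI b0 (HS u0)); lra.
have ez : h z = H z.
  by apply: step_unique rz0 (hz Dz) _; rewrite hz0; exact: Hz.
have eD z' : open_strip v e' z' -> h z' = H z'.
  move=> Dz'; exact: (step_map_eq (@convex_open_strip v e') hD.1 HD hD.2 Dz Dz' ez).
have hn : \forall z \near z1, near_point (h z1) (z - z1).
  apply/near_shiftP; apply: filterS (near_near_point (h z1)) => d.
  by rewrite addrAC subrr add0r.
have [z' Dz' [hz' [Hz' nz']]] : exists2 z', open_strip v e' z' &
    (open_strip v e' z' -> step (h z1) (z' - z1) (h z')) /\
    ((open_strip v e' z' -> step (H z1) (z' - z1) (H z')) /\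
     near_point (h z1) (z' - z1)).
  by apply: (open_strip_near e'0) (filterI b1 (filterI (HS (1 + u1)) hn)); lra.
(* Back to the boundary: the end point of a short displacement determines its origin. *)
have e1 : h z1 = H z1.
  by apply: step_inj_src nz' (hz' Dz') _; rewrite eD//; exact: Hz'.
by apply: (@pt_inj_edge _ _ s t _ _ _ _ us1 hl); rewrite -hz1 -Hz1.
Qed.

Lemma codeL_eq v (c : 'S_n) : v != 0 -> (forall l, 0 <= v l 0) ->
  (forall i, exists2 H : V -> X, strip v i H & strip v (c i) (fun z => H (dir v + z))) ->
  codeL R s t v = c.
Proof.
move=> v0 vp hc; apply: xget_unique => [i|c' hc'].
  by have [H h1 h2] := hc i; exact: strip_next h1 h2.
apply/permP => i; have [H h1 h2] := hc i; have [C [_ _ hn]] := hc' i.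
exact: strip_unique h1 h2 hn.
Qed.

End StripUniqueness.

(** * Computation of the codes by transporting horizontal and vertical strips *)

Section Codes.
Context {R : realType} {n : nat}.
Local Notation V := 'cV[R]_2.
Local Notation usq := (unit_square R).
Implicit Types (s t : 'S_n) (v : 'cV[int]_2).

Lemma hpt_regular s t i (a b : R) : 0 <= b <= 1 ->
  0 < b < 1 \/ (forall m : int, a <> m%:~R) -> regular (hpt i a b : surface R s t).
Proof.
move=> hb h; pose m := Num.floor a.
have := floor_le a; have := floorD1_gt a; rewrite -/m intrD => h1 h2.
have hm : m%:~R <= a <= m%:~R + 1 by lra.
have hq : usq (vec2 (a - m%:~R) b) by apply: usq_vec2 => //; lra.
have e : hpt i a b = pt (permz s m i) (vec2 (a - m%:~R) b) :> surface R s t by exact: hptE.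
case: h => [hb'|/(_ m) ha]; first by apply: (interior_regular (k := 1) hq e); rewrite mxE.
apply: (interior_regular (k := 0) hq e); rewrite mxE /=.
have /eqP am := ha; have : m%:~R < a by rewrite lt_neqAle eq_sym am.
by lra.
Qed.

Lemma strip_horizontal s t i :
  strip (vec2 1 0) i (fun z : V => hpt i (z 0 0) (z 1 0) : surface R s t).
Proof.
have cE (z : V) : cross (dir (vec2 1 0)) z = z 1 0 by rewrite /cross !mxE /=; ring.
have uE (z : V) : usq z -> hpt i (z 0 0) (z 1 0) = pt i z :> surface R s t by exact: hpt_pt.
split.
- move=> z; rewrite /slab /= cE => hz.
  have hb : 0 <= z 1 0 <= 1 by lra.
  apply: filterS (@hpt_step R n s t i (z 0 0) (z 1 0) hb) => d h.
  by rewrite /slab /= cE mxE => hd; rewrite [(z + d) 0 0]mxE; apply: h; lra.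
- move=> z; rewrite /slab /= cE => hz h; apply: hpt_regular; first lra.
  have [z0|/eqP z0] := eqVneq (z 1 0) 0; last by left; lra.
  right=> m em; case: h => [|/(_ m)]; first lra.
  by apply; apply: vec2_eq; rewrite !mxE /= ?em ?z0; ring.
- exists 1 => // u hu; rewrite uE// => l; rewrite !mxE /=.
  by move: l; apply: ord2_ind => /=; lra.
Qed.

(** On the left of the left side of [Q_i] is the column through the square [(s^-1)%g i], seen as a
    row of X(t, s); hence the conjugation by [s] in the vertical code. As [z 0 0] is in ]-1, 0], the
    position across the column is [1 + z 0 0]. *)
Lemma strip_vertical s t i : strip (vec2 0 1) i (fun z : V =>
  flip (hpt ((s^-1)%g i) (z 1 0) (1 + z 0 0) : surface R t s) : surface R s t).
Proof.
have cE (z : V) : cross (dir (vec2 0 1)) z = - z 0 0 by rewrite /cross !mxE /=; ring.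
split.
- move=> z; rewrite /slab /= cE => hz.
  have hb : 0 <= 1 + z 0 0 <= 1 by lra.
  have h1 := @hpt_step R n t s ((s^-1)%g i) (z 1 0) (1 + z 0 0) hb.
  pose J : 'M[R]_2 := map_mx intr swap_mx.
  have JE (d : V) : J *m d = vec2 (d 1 0) (d 0 0) by exact: swap_mxE.
  have JJ (d : V) : J *m (J *m d) = d by rewrite !JE; apply: vec2_eq; rewrite !mxE.
  have h2 := @flip_affine R n s t (hpt ((s^-1)%g i) (z 1 0) (1 + z 0 0)).
  apply: filterS2 (near0_mulmx J h1) (near0_mulmx J h2) => d h3 h4.
  rewrite /slab /= cE mxE => hd.
  have : step (hpt ((s^-1)%g i) (z 1 0) (1 + z 0 0) : surface R t s) (J *m d)
      (hpt ((s^-1)%g i) (z 1 0 + (J *m d) 0 0) (1 + z 0 0 + (J *m d) 1 0)).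
    by apply: h3; rewrite JE mxE /=; lra.
  move=> /h4; rewrite JJ; congr (step _ _ (flip (hpt _ _ _))); rewrite JE !mxE //=.
  by rewrite addrA.
- move=> z; rewrite /slab /= cE => hz h.
  apply: (affine_regular (can_inj (@flipK R n t s)) (@flip_affine R n t s _)).
  rewrite flipK; apply: hpt_regular; first lra.
  have [z0|/eqP z0] := eqVneq (z 0 0) 0; last by left; lra.
  right=> m em; case: h => [|/(_ m)]; first lra.
  by apply; apply: vec2_eq; rewrite !mxE /= ?em ?z0; ring.
- exists 1 => // u hu.
  have e1 : (u *: dir (vec2 0 1)) 0 0 = 0 :> R by rewrite !mxE /=; ring.
  have e2 : (u *: dir (vec2 0 1)) 1 0 = u :> R by rewrite !mxE /=; ring.
  have hu1 : usq (vec2 u 1) by apply: usq_vec2; lra.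
  rewrite e1 e2 addr0 -[u](_ : (vec2 u 1) 0 0 = u); last by rewrite mxE.
  rewrite -[X in hpt _ _ X](_ : (vec2 u 1 : V) 1 0 = 1); last by rewrite mxE.
  rewrite hpt_pt// flip_pt// !mxE /=.
  have hu2 : usq (vec2 1 u) by apply: usq_vec2; lra.
  rewrite -(@pt_glue _ _ s t 0 _ (vec2 1 u))//.
    rewrite /side_perm /= permKV; congr pt; apply: vec2_eq; rewrite !mxE /=; ring.
  by apply: ord2_ind; rewrite !mxE /=; lra.
Qed.

(** Determinant 1 preserves the cross product, so slabs correspond; the label clause of the marked
    isomorphism carries the beginning of gamma_i. *)
Lemma strip_transport s' t' s t (F : surface R s' t' -> surface R s t) G
    (A C : 'M[int]_2) v i H :
  \det A = 1 -> A *m C = 1%:M -> C *m A = 1%:M ->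
  cancel F G -> cancel G F ->
  affine_map F (map_mx intr A) -> affine_map G (map_mx intr C) ->
  (forall i, \forall z \near (0 : V), (forall l, 0 <= (z : V) l 0) ->
        F (pt i z) = pt i (map_mx intr A *m z)) ->
  (forall l, 0 <= v l 0) ->
  strip v i H -> strip (A *m v) i (fun z => F (H (map_mx intr C *m z))).
Proof.
move=> dA AC CA FG GF hF hG lF v0 [hs hr [e e0 he]].
set B := map_mx intr A in hF lF *; set D := map_mx intr C in hG *.
have BD : B *m D = 1%:M by rewrite -map_mxM AC map_mx1.
have DB : D *m B = 1%:M by rewrite -map_mxM CA map_mx1.
have dE : dir (A *m v) = B *m dir v :> V by rewrite /dir map_mxM.
have cE (z : V) : cross (dir (A *m v)) z = cross (dir v) (D *m z).
  rewrite dE -[z in LHS]mul1mx -BD -mulmxA cross_mulmx !mxE.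
  by rewrite -!rmorphM -rmorphB /= -det2 dA mul1r.
have rF x : regular x -> regular (F x).
  by move=> rx; apply: (affine_regular (can_inj GF) (hG _)); rewrite FG.
split.
- move=> z; rewrite /slab /= cE => hz.
  have := hs _ hz; move=> /(near0_mulmx D) h1; have h2 := near0_mulmx D (hF (H (D *m z))).
  apply: filterS2 h1 h2 => d h3 h4; rewrite /slab /= cE mulmxDr => /h3/h4.
  by rewrite mulmxA BD mul1mx.
- move=> z; rewrite /slab /= cE => hz h; apply/rF/hr => //.
  case: h => [|h]; first by left.
  right=> m em; apply: (h m); rewrite dE scalemxAr -em mulmxA BD mul1mx //.
- have [e' e'0 he'] := near0_ray (dir v) (lF i).
  exists (Num.min e e'); first by rewrite lt_min e0.
  move=> u; rewrite lt_min => /and3P[u0 ue ue'].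
  rewrite dE -!scalemxAr mulmxA DB mul1mx he ?u0// he' ?u0 ?ue'// 1?scalemxAr//.
  by move=> l; rewrite !mxE mulr_ge0// ler0z.
Qed.

(** Shifting a horizontal or vertical strip of X(s', t') by one period gives the strip of the same
    shape with the next label, and [F] keeps labels. *)
Lemma codeLM_marked_iso s' t' s t (A : 'M[int]_2) : SL2plus A ->
  marked_iso (R := R) s' t' s t A -> codeLM R s t A = (s', (s'^-1 * t' * s')%g).
Proof.
move=> [dA A0] [F [G [C [[FG GF] [AC CA] hF hG lF]]]].
have colA j : col j A = A *m col j 1%:M by rewrite !colE mul1mx.
have c0 : col 0 1%:M = vec2 1 0 :> 'cV[int]_2 by apply: vec2_eq; rewrite !mxE.
have c1 : col 1 1%:M = vec2 0 1 :> 'cV[int]_2 by apply: vec2_eq; rewrite !mxE.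
have col0 j : col j A != 0.
  apply/eqP => /(congr1 (mulmx C)); rewrite colA mulmxA CA mul1mx mulmx0.
  move: j; apply: ord2_ind; rewrite ?c0 ?c1 => h.
    by have := congr1 (fun p : 'cV[int]_2 => p 0 0) h; rewrite !mxE.
  by have := congr1 (fun p : 'cV[int]_2 => p 1 0) h; rewrite !mxE.
have colp j l : 0 <= col j A l 0 by rewrite mxE.
have tr := strip_transport dA AC CA FG GF hF hG lF.
have DB : map_mx intr C *m map_mx intr A = 1%:M :> 'M[R]_2.
  by rewrite -map_mxM CA map_mx1.
have e10 l : 0 <= (vec2 1 0 : 'cV[int]_2) l 0 by rewrite mxE; case: ifP.
have e01 l : 0 <= (vec2 0 1 : 'cV[int]_2) l 0 by rewrite mxE; case: ifP.
congr pair.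
- apply: codeL_eq => // i; rewrite colA c0.
  exists (fun z => F (hpt i ((map_mx intr C *m z) 0 0) ((map_mx intr C *m z) 1 0))).
    exact: (tr _ _ _ e10 (strip_horizontal s' t' i)).
  rewrite (_ : (fun z => _) = (fun z => F (hpt (s' i)
    ((map_mx intr C *m z) 0 0) ((map_mx intr C *m z) 1 0)))).
    exact: (tr _ _ _ e10 (strip_horizontal s' t' (s' i))).
  apply/funext => z; congr F.
  rewrite /dir map_mxM mulmxDr mulmxA DB mul1mx -[s' i](_ : permz s' 1 i = s' i).
    by rewrite -hpt_shift !mxE /=; congr (hpt _ _ _); ring.
  by rewrite permz1.
- apply: codeL_eq => // i; rewrite colA c1.
  exists (fun z => F (flip (hpt ((s'^-1)%g i) ((map_mx intr C *m z) 1 0)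
      (1 + (map_mx intr C *m z) 0 0) : surface R t' s'))).
    exact: (tr _ _ _ e01 (strip_vertical s' t' i)).
  rewrite (_ : (fun z => _) = (fun z => F (flip (hpt ((s'^-1)%g ((s'^-1 * t' * s')%g i))
      ((map_mx intr C *m z) 1 0) (1 + (map_mx intr C *m z) 0 0) : surface R t' s')))).
    exact: (tr _ _ _ e01 (strip_vertical s' t' _)).
  apply/funext => z; congr (F (flip _)).
  rewrite !permM permK /dir map_mxM mulmxDr mulmxA DB mul1mx.
  rewrite -[t' _](_ : permz t' 1 (s'^-1%g i) = t' (s'^-1%g i)); last by rewrite permz1.
  by rewrite -hpt_shift !mxE /=; congr (hpt _ _ _); ring.
Qed.

End Codes.

(** * Translations between square-tiled surfaces *)

Section Translations.
Context {R : realType} {n : nat}.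
Local Notation V := 'cV[R]_2.
Local Notation usq := (unit_square R).
Implicit Types (s t : 'S_n).

(** Restricted to regular points, the only ones about which [affine_diffeoE] speaks. *)
Definition translation_iso s t s' t' (g : surface R s t -> surface R s' t') : Prop :=
  forall x, regular x -> regular (g x) /\ affine_at g 1%:M x.

Lemma translation_iso_inv s t s' t' (g : surface R s t -> surface R s' t') g' :
  cancel g g' -> cancel g' g -> (forall x, regular (g x) -> regular x) ->
  translation_iso g -> translation_iso g'.
Proof.
move=> gK g'K gr hg y ry.
have rx : regular (g' y) by apply: gr; rewrite g'K.
split=> //; have [_ h1] := hg _ rx; rewrite /affine_at in h1 *.
apply: filterS2 h1 (near_near_point (g' y)) => d h1 h2 w hw.
have [z hz] := step_exists h2; rewrite mul1mx.
have := h1 _ hz; rewrite mul1mx g'K => hz'.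
by rewrite (step_unique ry hw hz') gK.
Qed.

Lemma translation_iso_comp s t s' t' (g : surface R s t -> surface R s' t') D h :
  translation_iso g -> local_translation D h -> local_translation D (g \o h).
Proof.
move=> hg hh z Dz; have [rz /near_shiftP hz] := hh z Dz; have [rg ag] := hg _ rz.
split=> //; apply/near_shiftP; rewrite /affine_at in ag.
apply: filterS2 hz ag => d h1 h2 /h1.
by rewrite addrAC subrr add0r => /h2; rewrite mul1mx.
Qed.

Definition open_square : set V := [set z | forall k, 0 < z k 0 < 1].

Lemma convex_open_square : convex_set2 open_square.
Proof.
by move=> z z' u hz hz' hu k; rewrite !mxE; exact: (conv_itv _ _ _ _ hu).2.
Qed.

Lemma open_square_usq z : open_square z -> usq z.
Proof. by move=> hz k; have := hz k; lra. Qed.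

Lemma open_square_local s t i :
  local_translation open_square (fun z => pt i z : surface R s t).
Proof.
apply: local_translationI => [z hz|z hz].
  exact: interior_regular (open_square_usq hz) (erefl _) (hz 0).
apply: (@nearW _ (nbhs (0 : V))) => d hzd; exists i, z.
by split=> //; exact: open_square_usq.
Qed.

Definition open_band : set V := [set z | 0 < z 1 0 < 1].

Lemma convex_open_band : convex_set2 open_band.
Proof.
by move=> z z' u hz hz' hu; rewrite /open_band /= !mxE; exact: (conv_itv _ _ _ _ hu).2.
Qed.

Lemma open_band_local s t i :
  local_translation open_band (fun z => hpt i (z 0 0) (z 1 0) : surface R s t).
Proof.
apply: local_translationI => [z hz|z hz].
  by apply: hpt_regular; [move: hz; rewrite /open_band /=; lra|left].
have hb : 0 <= z 1 0 <= 1 by move: hz; rewrite /open_band /=; lra.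
apply: filterS (@hpt_step R n s t i (z 0 0) (z 1 0) hb) => d h.
by rewrite /open_band /= !mxE => hd; apply: h; lra.
Qed.

Definition frac_itv (c : V) : Prop := forall k, 0 <= c k 0 < 1.
(* For c in [0, 1)^2, the point (1 - c)/2 and its translate by c are both interior to
   the unit square. *)
Definition low_point (c : V) : V := \col_k ((1 - c k 0) / 2).
Definition high_point (c : V) : V := \col_k ((1 + c k 0) / 2).

Lemma low_pointD c : low_point c + c = high_point c.
Proof. by apply/colP => k; rewrite !mxE; field. Qed.

Lemma high_pointB c : high_point c - c = low_point c.
Proof. by rewrite -low_pointD addrK. Qed.

Lemma low_point_open c : frac_itv c -> open_square (low_point c).
Proof. by move=> hc k; rewrite mxE; have := hc k; lra. Qed.

Lemma high_point_open c : frac_itv c -> open_square (high_point c).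
Proof. by move=> hc k; rewrite mxE; have := hc k; lra. Qed.

Lemma frac_itv_eq c c' : frac_itv c -> frac_itv c' -> intv (c - c') -> c = c'.
Proof.
move=> hc hc' hi; apply/eqP; rewrite -subr_eq0; apply/eqP/intv_small => // k.
by have := hc k; have := hc' k; rewrite !mxE ltr_norml; lra.
Qed.

(** [c] is the fractional part of the displacement of [g] on [Q_i]. The centre of [Q_i] would not do
    as test point: its translate by [c] may fall on a side. *)
Definition matches s t s' t' (g : surface R s t -> surface R s' t') i j c : Prop :=
  frac_itv c /\ g (pt i (low_point c)) = pt j (high_point c).

Lemma pt_inj_open s t i j z : open_square z -> pt i z = pt j z :> surface R s t -> i = j.
Proof. by move=> hz; exact: (pt_inj_edge (open_square_usq hz) (hz 0)). Qed.

Section Match.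
Variables (s t s' t' : 'S_n) (g : surface R s t -> surface R s' t').
Hypothesis hg : translation_iso g.

Lemma displacement i z z' c : open_square z -> open_square z' ->
  intv (tor (g (pt i z)) - z - c) -> intv (tor (g (pt i z')) - z' - c).
Proof.
move=> hz hz'.
have hl := local_translation_step_map (translation_iso_comp hg (@open_square_local s t i)).
exact: (step_map_tor convex_open_square hl hz hz').
Qed.

Lemma matches_tor i j c z : matches g i j c -> open_square z ->
  intv (tor (g (pt i z)) - z - c).
Proof.
move=> [hc e] hz; apply: (displacement (low_point_open hc) hz).
rewrite -addrA -opprD low_pointD; apply: (tor_pt _ e).
exact/open_square_usq/high_point_open.
Qed.

Lemma matches_exists i : exists j c, matches g i j c.
Proof.
pose z : V := \col_k (1 / 2).
have hz : open_square z by move=> k; rewrite mxE; lra.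
pose a := tor (g (pt i z)) - z.
pose c : V := \col_k (a k 0 - (Num.floor (a k 0))%:~R).
have hc : frac_itv c.
  move=> k; rewrite mxE; have := floor_le (a k 0); have := floorD1_gt (a k 0).
  by rewrite intrD; lra.
have h1 : intv (tor (g (pt i z)) - z - c).
  move=> k; rewrite -/a mxE [(- c) k 0]mxE [c k 0]mxE opprB addrC subrK.
  exact: intr_int.
have := displacement hz (low_point_open hc) h1.
have [j [q [hq ej]]] := pt_surj (g (pt i (low_point c))).
rewrite -addrA -opprD low_pointD => h2.
exists j, c; split=> //; rewrite ej; congr pt.
have h3 := tor_pt hq ej.
apply/eqP; rewrite -subr_eq0; apply/eqP/intv_small => [|k].
  rewrite (_ : q - _ = (tor (g (pt i (low_point c))) - high_point c) -
    (tor (g (pt i (low_point c))) - q)).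
    by apply: intvD => //; exact: intvN.
  by apply/colP => k; rewrite !mxE; ring.
have := hq k; have := high_point_open hc k; rewrite [(q - _) k 0]mxE [(- high_point c) k 0]mxE.
by rewrite ltr_norml; lra.
Qed.

Lemma matches_unique i j j' c c' : matches g i j c -> matches g i j' c' -> j = j'.
Proof.
move=> m m'; have [hc e] := m; have [hc' e'] := m'.
have hz := low_point_open hc.
have h1 := matches_tor m hz; have h2 := matches_tor m' hz.
have cc : c = c'.
  apply: frac_itv_eq => //; set a := tor _ - _ in h1 h2.
  rewrite (_ : c - c' = (a - c') - (a - c)); first by apply: intvD => //; exact: intvN.
  by apply/colP => k; rewrite !mxE; ring.
subst c'; apply: (@pt_inj_open s' t' _ _ _ (high_point_open hc)).
by rewrite -e -e'.
Qed.

(** The image under [g] of the row of [i] and the row of [j] translated by [c] agree at the low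
    point, hence also one square further to the right. *)
Lemma matches_horizontal i j c : matches g i j c -> matches g (s i) (s' j) c.
Proof.
move=> m; have [hc e] := m; split=> //.
(* Both rows are open here, so the continuation stays among regular points. *)
pose D : set V := [set z | open_band z /\ open_band (z + c)].
have cD : convex_set2 D.
  move=> z z' u [h1 h2] [h1' h2'] hu; split; first exact: convex_open_band.
  rewrite (_ : _ + c = (z + c) + u *: ((z' + c) - (z + c))); first exact: convex_open_band.
  by apply/colP => k; rewrite !mxE; ring.
have hl := translation_iso_comp hg (@open_band_local s t i).
have hl' := @open_band_local s' t' j.
have s1 : step_map D (g \o (fun z => hpt i (z 0 0) (z 1 0))).
  by apply: step_mapS (local_translation_step_map hl) => z [].
have s2 : step_map D (fun z => hpt j ((z + c) 0 0) ((z + c) 1 0) : surface R s' t').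
  move=> z [_ hz]; have := local_translation_step_map hl' hz.
  apply: filterS => d h [_]; rewrite [z + d + c]addrAC; exact: h.
have r1 z : D z -> regular ((g \o (fun z => hpt i (z 0 0) (z 1 0))) z).
  by move=> [hz _]; have [] := hl z hz.
have lo := low_point_open hc; have hi := high_point_open hc.
have D0 : D (low_point c) by split; rewrite ?low_pointD; [exact: lo|exact: hi].
have D1 : D (low_point c + side 0).
  by split; rewrite /open_band /= !mxE /=; have := hc 1; lra.
have eq0 : (g \o (fun z => hpt i (z 0 0) (z 1 0))) (low_point c) =
    hpt j ((low_point c + c) 0 0) ((low_point c + c) 1 0).
  rewrite low_pointD /= !hpt_pt//; exact: open_square_usq.
have := step_map_eq cD s1 s2 r1 D0 D1 eq0.
have sh s0 t0 k (z : V) : usq z ->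
    hpt k ((z + side 0) 0 0) ((z + side 0) 1 0) = pt (s0 k) z :> surface R s0 t0.
  move=> hz; rewrite -hpt_pt// -[s0 k](_ : permz s0 1 k = s0 k); last by rewrite permz1.
  by rewrite -hpt_shift !mxE /=; congr (hpt _ _ _); rewrite ?addr0.
rewrite /= [low_point c + side 0 + c]addrAC low_pointD !sh//.
- exact: open_square_usq.
- exact: open_square_usq.
Qed.

End Match.

Lemma matches_flip s t s' t' (g : surface R s t -> surface R s' t') i j c :
  matches g i j c <->
  matches (@flip R n t' s' \o g \o @flip R n s t) i j (vec2 (c 1 0) (c 0 0)).
Proof.
have hf (c' : V) : frac_itv c' -> frac_itv (vec2 (c' 1 0) (c' 0 0)).
  by move=> hc; apply: ord2_ind; rewrite mxE /=; exact: hc.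
have lE (c' : V) : vec2 (low_point c' 1 0) (low_point c' 0 0) =
    low_point (vec2 (c' 1 0) (c' 0 0)).
  by apply: vec2_eq; rewrite !mxE.
have hE (c' : V) : vec2 (high_point c' 1 0) (high_point c' 0 0) =
    high_point (vec2 (c' 1 0) (c' 0 0)).
  by apply: vec2_eq; rewrite !mxE.
have cc : vec2 ((vec2 (c 1 0) (c 0 0) : V) 1 0) ((vec2 (c 1 0) (c 0 0) : V) 0 0) = c.
  by apply: vec2_eq; rewrite !mxE.
split=> -[hc e]; split; first exact: hf.
- have lo := open_square_usq (low_point_open (hf _ hc)).
  have hi := open_square_usq (high_point_open hc).
  by rewrite /= flip_pt// lE cc e flip_pt// hE.
- by rewrite -cc; exact: hf.
- have hc' : frac_itv c by rewrite -cc; exact: hf.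
  have lo := open_square_usq (low_point_open hc).
  have hi := open_square_usq (high_point_open hc').
  apply: (can_inj (@flipK R n t' s')); move: e; rewrite /= flip_pt; last first.
    exact/open_square_usq/low_point_open.
  by rewrite lE cc => ->; rewrite flip_pt ?hE.
Qed.

Lemma translation_iso_flip s t s' t' (g : surface R s t -> surface R s' t') :
  translation_iso g -> translation_iso (@flip R n t' s' \o g \o @flip R n s t).
Proof.
move=> hg x rx.
have fr s0 t0 (y : surface R t0 s0) : regular y -> regular (flip y).
  move=> ry; apply: (affine_regular (can_inj (@flipK R n t0 s0)) (@flip_affine R n t0 s0 _)).
  by rewrite flipK.
have [r1 a1] := hg _ (fr _ _ _ rx); split; first exact: fr.
have h1 := affine_comp (@flip_affine R n s t x) a1.
have := affine_comp h1 (@flip_affine R n t' s' _).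
rewrite mul1mx -map_mxM (_ : swap_mx *m swap_mx = 1%:M) ?map_mx1//.
by apply/matrixP; apply: ord2_ind; apply: ord2_ind;
  rewrite !mxE !big_ord_recl big_ord0 !mxE /=; ring.
Qed.

Lemma matches_vertical s t s' t' (g : surface R s t -> surface R s' t') i j c :
  translation_iso g -> matches g i j c -> matches g (t i) (t' j) c.
Proof.
move=> hg m; apply/(matches_flip g (t i) (t' j) c).
have {}m := (matches_flip g i j c).1 m.
exact: (matches_horizontal (translation_iso_flip hg) m).
Qed.

(** The inverse displaces [Q_j] by [- c] and by [- c'], so the two fractional displacements agree
    and the low points have the same image. *)
Lemma matches_inj s t s' t' (g : surface R s t -> surface R s' t') g' i i' j c c' :
  translation_iso g' -> cancel g g' ->
  matches g i j c -> matches g i' j c' -> i = i'.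
Proof.
move=> hg' gK [hc e] [hc' e'].
have lo := low_point_open hc; have hi := high_point_open hc.
have lo' := low_point_open hc'; have hi' := high_point_open hc'.
have gE : g' (pt j (high_point c)) = pt i (low_point c) by rewrite -e gK.
have gE' : g' (pt j (high_point c')) = pt i' (low_point c') by rewrite -e' gK.
have t1 : intv (tor (g' (pt j (high_point c))) - high_point c - (- c)).
  by rewrite -addrA -opprD high_pointB; apply: (tor_pt _ gE); exact: open_square_usq.
have t2 : intv (tor (g' (pt j (high_point c'))) - high_point c' - (- c')).
  by rewrite -addrA -opprD high_pointB; apply: (tor_pt _ gE'); exact: open_square_usq.
have := displacement hg' hi' hi t2; set a := tor _ - _ in t1 * => t3.
have cc : c = c'.
  apply: frac_itv_eq => //.
  rewrite (_ : c - c' = (a - - c) - (a - - c')); first by apply: intvD => //; exact: intvN.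
  by apply/colP => k; rewrite !mxE; ring.
subst c'; apply: (@pt_inj_open s t _ _ _ lo).
by rewrite -gE -gE'.
Qed.

(** The surface may be disconnected, so each square has its own [c]; the matching of a square
    passes, with the same [c], to its neighbours. *)
Lemma translation_iso_conj s t s' t' (g : surface R s t -> surface R s' t') g' :
  cancel g g' -> translation_iso g -> translation_iso g' ->
  exists w : 'S_n, (forall i, s' (w i) = w (s i)) /\ (forall i, t' (w i) = w (t i)).
Proof.
move=> gK hg hg'.
have /choice[f hf] : forall i, exists j, exists c, matches g i j c.
  by move=> i; exact: matches_exists.
have fI : injective f.
  move=> i i' e; have [c hc] := hf i; have [c' hc'] := hf i'.
  by rewrite -e in hc'; exact: matches_inj hg' gK hc hc'.
exists (perm fI); split=> i; rewrite !permE; have [c hc] := hf i.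
  have [c' hc'] := hf (s i).
  exact: (matches_unique hg (matches_horizontal hg hc) hc').
have [c' hc'] := hf (t i).
exact: (matches_unique hg (matches_vertical hg hc) hc').
Qed.

End Translations.

(** * The groups *)

Lemma SL2plus1 : SL2plus 1%:M.
Proof. by split; [exact: det1|move=> i j; rewrite mxE; case: eqP]. Qed.

Lemma SL2plusM A B : SL2plus A -> SL2plus B -> SL2plus (A *m B).
Proof.
move=> [dA A0] [dB B0]; split; first by rewrite det_mulmx dA dB mulr1.
by move=> i j; rewrite mxE sumr_ge0// => k _; rewrite mulr_ge0.
Qed.

Lemma SL2plus_shear : SL2plus (shear_mx 1).
Proof.
split; first by rewrite det2 !mxE.
by apply: ord2_ind; apply: ord2_ind; rewrite !mxE.
Qed.

Lemma SL2plus_shearT : SL2plus (shear_mx 1)^T.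
Proof. by case: SL2plus_shear => dU U0; split; [rewrite det_tr|move=> i j; rewrite mxE]. Qed.

Section Main.
Context {R : realType} {n : nat} {s t : 'S_n}.
Local Notation code A := (codeLM R s t A).
Local Notation base := (code 1%:M%R).
Local Open Scope group_scope.

Lemma SL2plus_marked_iso A : SL2plus A -> exists s' t', marked_iso (R := R) s' t' s t A.
Proof.
move: A; apply: SL2plus_ind.
- by exists s, t; exact: marked_iso_id.
- move=> A hA [s' [t' h]]; exists s', (s' * t').
  by apply: marked_iso_comp h (marked_iso_shear _ _); case: SL2plus_shear.
- move=> A hA [s' [t' h]]; exists (t' * s'), t'.
  by apply: marked_iso_comp h (marked_iso_shearT _ _); case: SL2plus_shearT.
Qed.

Lemma codeLM1 : base = (s, s^-1 * t * s).
Proof. exact: codeLM_marked_iso SL2plus1 (marked_iso_id s t). Qed.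

(** The tiling permutations become [(s', s' * t')]; conjugating the second by [s'] gives [t' * s'],
    the product of the two components of the old code. *)
Lemma codeLM_shear A : SL2plus A ->
  code (A *m shear_mx 1)%R = ((code A).1, (code A).1 * (code A).2).
Proof.
move=> hA; have [s' [t' h]] := SL2plus_marked_iso hA.
have [_ U0] := SL2plus_shear.
have h2 := marked_iso_comp U0 h (marked_iso_shear s' t').
rewrite (codeLM_marked_iso hA h) (codeLM_marked_iso (SL2plusM hA SL2plus_shear) h2) /=.
by rewrite !mulgA mulVg mul1g mulgV mul1g.
Qed.

Lemma codeLM_shearT A : SL2plus A ->
  code (A *m (shear_mx 1)^T)%R = ((code A).1 * (code A).2, (code A).2).
Proof.
move=> hA; have [s' [t' h]] := SL2plus_marked_iso hA.
have [_ U0] := SL2plus_shearT.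
have h2 := marked_iso_comp U0 h (marked_iso_shearT s' t').
rewrite (codeLM_marked_iso hA h) (codeLM_marked_iso (SL2plusM hA SL2plus_shearT) h2) /=.
by rewrite invMg !mulgA mulgV mul1g mulgKV.
Qed.

Lemma conj_pairM u w (c : 'S_n * 'S_n) :
  conj_pair (u * w) c = conj_pair u (conj_pair w c).
Proof. by rewrite /conj_pair /= invMg !mulgA. Qed.

Lemma conj_pair1 (c : 'S_n * 'S_n) : conj_pair 1 c = c.
Proof. by case: c => a b; rewrite /conj_pair /= invg1 !mul1g !mulg1. Qed.

Lemma conj_pair_inj (u : 'S_n) : injective (conj_pair u).
Proof.
by move=> c c' e; rewrite -[c]conj_pair1 -[c']conj_pair1 -(mulVg u) !conj_pairM e.
Qed.

Lemma codeLM_mul_conj A B u : SL2plus A -> SL2plus B ->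
  conj_pair u base = code A -> conj_pair u (code B) = code (A *m B)%R.
Proof.
move=> hA hB e; move: B hB; apply: SL2plus_ind; first by rewrite mulmx1.
- move=> B hB IH; rewrite mulmxA (codeLM_shear hB) (codeLM_shear (SL2plusM hA hB)).
  by rewrite -IH /conj_pair /= !mulgA mulgKV.
- move=> B hB IH; rewrite mulmxA (codeLM_shearT hB) (codeLM_shearT (SL2plusM hA hB)).
  by rewrite -IH /conj_pair /= !mulgA mulgKV.
Qed.

Lemma codeLM_Veech A : Veech_plus R s t A -> exists u, conj_pair u base = code A.
Proof.
move=> [[f hf] hA]; have [s' [t' hi]] := SL2plus_marked_iso hA.
rewrite (codeLM_marked_iso hA hi) codeLM1.
have [F [G [C [[FG GF] [AC CA] hF hG _]]]] := hi.
have [_ [_ [f' [_ fK f'K]]] _ _] := hf.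
have hfr := affine_diffeoE hf.
pose g := G \o f; pose g' := f' \o F.
have gK : cancel g g' by move=> x; rewrite /g /g' /= GF fK.
have g'K : cancel g' g by move=> x; rewrite /g /g' /= f'K FG.
have rG x : regular x -> regular (G x).
  by move=> rx; apply: (affine_regular (can_inj FG) (hF _)); rewrite GF.
have g_iso : translation_iso g.
  move=> x rx; have [rf af] := hfr x rx; split; first exact: rG.
  by have := affine_comp af (hG (f x)); rewrite -map_mxM CA map_mx1.
have regf x : regular (f x) -> regular x.
  move=> rfx; apply: contrapT => /zerosE zx.
  have [_ _ fz _] := hf; have : (f @` zeros)%classic (f x) by exists x.
  by rewrite fz => /zerosE.
have g_reg x : regular (g x) -> regular x.
  by move=> rx; apply/regf/(affine_regular (can_inj GF) (hG _)).
have [w [ws wt]] := translation_iso_conj gK g_iso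
  (translation_iso_inv gK g'K g_reg g_iso).
(* Products act from left to right, so [s' (w i) = w (s i)] reads [w * s' = s * w]. *)
have es : s' = w^-1 * s * w by apply/permP => i; rewrite !permM -ws permKV.
have et : t' = w^-1 * t * w by apply/permP => i; rewrite !permM -wt permKV.
exists w^-1; rewrite /conj_pair /= invgK es et; congr pair.
by rewrite !invMg invgK !mulgA !mulgK.
Qed.

Lemma Veech_codeLM A u : SL2plus A -> conj_pair u base = code A -> Veech_plus R s t A.
Proof.
move=> hA; have [s' [t' hi]] := SL2plus_marked_iso hA.
rewrite (codeLM_marked_iso hA hi) codeLM1 /conj_pair /= => -[es et].
have [F [G [C [[FG GF] [AC CA] hF hG _]]]] := hi.
have {}et : t' = u * t * u^-1.
  have -> : t' = s' * (s'^-1 * t' * s') * s'^-1 by rewrite !mulgA mulgV mul1g mulgK.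
  by rewrite -et -es !invMg !invgK !mulgA !(mulgKV, mulgK).
have hs i : s' (u^-1 i) = u^-1 (s i) by rewrite -es !permM permKV.
have ht i : t' (u^-1 i) = u^-1 (t i) by rewrite et !permM permKV.
have hs' i : s (u i) = u (s' i) by rewrite -es !permM permKV.
have ht' i : t (u i) = u (t' i) by rewrite et !permM permKV.
split=> //; exists (F \o @relabel R n s t s' t' u^-1).
have hr := @relabel_affine R n _ _ _ _ _ hs ht.
have hr' := @relabel_affine R n _ _ _ _ _ hs' ht'.
have rK := @relabelK R n _ _ _ _ _ hs ht; have r'K := @relabelK R n _ _ _ _ _ hs' ht'.
rewrite invgK in rK.
apply: (@affine_diffeoI _ _ _ _ _ (@relabel R n s' t' s t u \o G) _ (1%:M *m map_mx intr C)%R).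
- by case: hA.
- by move=> x /=; rewrite FG rK.
- by move=> x /=; rewrite r'K GF.
- by move=> x; have := affine_comp (hr x) (hF _); rewrite mulmx1.
- by move=> x; exact: affine_comp (hG x) (hr' _).
Qed.

Lemma GXP u : reflect (exists2 A, SL2plus A & conj_pair u base = code A)
  (u \in GX R s t).
Proof. by rewrite inE; exact: asboolP. Qed.

Lemma group_set_GX : group_set (GX R s t).
Proof.
apply/group_setP; split.
  by apply/GXP; exists 1%:M%R; [exact: SL2plus1|rewrite conj_pair1].
move=> u w /GXP[A hA eA] /GXP[B hB eB]; apply/GXP.
exists (A *m B)%R; first exact: SL2plusM.
by rewrite conj_pairM eB; exact: codeLM_mul_conj.
Qed.
Definition GX_group := Group group_set_GX.

Lemma SXE u : (u \in SX R s t) = (conj_pair u base == base).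
Proof.
rewrite inE; case: eqP => e; rewrite ?andbF// andbT.
by apply/GXP; exists 1%:M%R => //; exact: SL2plus1.
Qed.

Lemma group_set_SX : group_set (SX R s t).
Proof.
apply/group_setP; split; first by rewrite SXE conj_pair1.
by move=> u w; rewrite !SXE conj_pairM => /eqP eu /eqP ew; rewrite ew eu.
Qed.
Definition SX_group := Group group_set_SX.

(** Elements fixing the base code fix all codes; this gives both normality of the subgroup and
    independence of the coset representative. *)
Lemma SX_fixes u A : u \in SX R s t -> SL2plus A -> conj_pair u (code A) = code A.
Proof.
rewrite SXE => /eqP hu hA.
by rewrite (codeLM_mul_conj SL2plus1 hA hu) mul1mx.
Qed.

Lemma SX_normal : normal SX_group GX_group.
Proof.
apply/andP; split; first by apply/fintype.subsetP => u; rewrite inE => /andP[].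
apply/fintype.subsetP => u hu; rewrite inE; apply/fintype.subsetP => _ /imsetP[w hw ->].
have /GXP[A hA eA] := hu.
by rewrite SXE conjgE !conj_pairM eA (SX_fixes hw hA) -eA -conj_pairM mulVg conj_pair1.
Qed.

Lemma code_VeechP c : reflect (exists2 u, u \in GX R s t & c = conj_pair u base)
  (c \in code_Veech_plus R s t).
Proof.
rewrite inE; apply: (iffP (asboolP _)) => [[A hA ->]|[u /GXP[A hA eA] ->]].
  have [u eu] := codeLM_Veech hA; exists u => //.
  by apply/GXP; exists A => //; case: hA.
by exists A => //; exact: Veech_codeLM eA.
Qed.
End Main.

Local Open Scope group_scope.

Theorem proposition5p3p1 (R : realType) (n : nat) (s t : 'S_n) :
  exists op : {c | c \in code_Veech_plus R s t} ->
              {c | c \in code_Veech_plus R s t} ->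
              {c | c \in code_Veech_plus R s t},
    [/\ forall (A B : 'M[int]_2) (x y : {c | c \in code_Veech_plus R s t}),
          Veech_plus R s t A -> Veech_plus R s t B ->
          val x = codeLM R s t A -> val y = codeLM R s t B ->
          val (op x y) = codeLM R s t (A *m B)%R,
        is_group op
      & exists G S : {group 'S_n},
          [/\ G = GX R s t :> {set 'S_n}, S = SX R s t :> {set 'S_n}, normal S G
            & exists Phi : coset_of S -> {c | c \in code_Veech_plus R s t},
                [/\ {in G, forall u, val (Phi (coset S u)) =
                       conj_pair u (codeLM R s t 1%:M%R)},
                    {in G / S &, {morph Phi : a b / a * b >-> op a b}},
                    {in G / S &, injective Phi}
                  & forall c, exists2 a, a \in G / S & Phi a = c]]].
Proof.
pose T := {c | c \in code_Veech_plus R s t}.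
pose base := codeLM R s t 1%:M%R.
have rootP (x : T) : exists u, u \in GX R s t /\ val x = conj_pair u base.
  by have /code_VeechP[u] := valP x; exists u.
pose root x := sval (cid (rootP x)).
have rootG x : root x \in GX R s t by rewrite /root; case: cid => u [].
have rootE x : val x = conj_pair (root x) base by rewrite /root; case: cid => u [].
pose mk (u : 'S_n) (hu : u \in GX R s t) : T :=
  exist _ (conj_pair u base) (introT (code_VeechP _) (ex_intro2 _ _ u hu erefl)).
pose op (x y : T) : T := mk _ (groupM (rootG x : root x \in @GX_group R n s t) (rootG y)).
(* Independence of the chosen roots: both sides are the code of [A *m B], whatever matrices and
   permutations represent [x] and [y]. *)
have opE x y u w : u \in GX R s t -> w \in GX R s t -> val x = conj_pair u base ->
    val y = conj_pair w base -> val (op x y) = conj_pair (u * w) base.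
  move=> /GXP[A hA eA] /GXP[B hB eB] ex ey; rewrite /= !conj_pairM -rootE ey eB.
  rewrite (codeLM_mul_conj hA hB eA) (codeLM_mul_conj hA hB)//.
  by rewrite -rootE ex eA.
have opE' x y := opE x y _ _ (rootG x) (rootG y) (rootE x) (rootE y).
have mkE u (hu : u \in GX R s t) : val (mk u hu) = conj_pair u base by [].
have GG u w : u \in GX R s t -> w \in GX R s t -> u * w \in GX R s t.
  exact: (@groupM _ (@GX_group R n s t)).
exists op; split.
- move=> A B x y [VA hA] [VB hB] ex ey.
  have [u eu] := codeLM_Veech (conj VA hA); have [w ew] := codeLM_Veech (conj VB hB).
  rewrite (opE x y u w); first by rewrite conj_pairM ew (codeLM_mul_conj hA hB eu).
  + by apply/GXP; exists A.
  + by apply/GXP; exists B.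
  + by rewrite ex eu.
  + by rewrite ey ew.
- split.
    move=> x y z; apply: val_inj.
    rewrite (opE _ _ _ _ (rootG x) (GG _ _ (rootG y) (rootG z)) (rootE x) (opE' y z)).
    by rewrite (opE _ _ _ _ (GG _ _ (rootG x) (rootG y)) (rootG z) (opE' x y) (rootE z)) mulgA.
  have G1 : 1 \in GX R s t := group1 (@GX_group R n s t).
  have GV x : (root x)^-1 \in GX R s t.
    exact: groupVr (rootG x : root x \in @GX_group R n s t).
  exists (mk 1 G1), (fun x => mk _ (GV x)); split=> x; apply: val_inj.
  + by rewrite (opE _ _ _ _ G1 (rootG x) (mkE _ G1) (rootE x)) mul1g rootE.
  + by rewrite (opE _ _ _ _ (rootG x) G1 (rootE x) (mkE _ G1)) mulg1 rootE.
  + by rewrite (opE _ _ _ _ (GV x) (rootG x) (mkE _ (GV x)) (rootE x)) mulVg.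
  + by rewrite (opE _ _ _ _ (rootG x) (GV x) (rootE x) (mkE _ (GV x))) mulgV.
exists (@GX_group R n s t), (@SX_group R n s t); split=> //; first exact: SX_normal.
set G := @GX_group R n s t; set S := @SX_group R n s t.
have nSG : normal S G by exact: SX_normal.
pose e : T := mk 1 (group1 G).
(* The default [e] only concerns cosets outside [G / S]; on the quotient the pair is always a
   code. *)
pose Phi (a : coset_of S) : T := insubd e (conj_pair (fingroup.repr a) base).
have PhiE u : u \in G -> val (Phi (coset S u)) = conj_pair u base.
  move=> hu; have nu : u \in 'N(S) by apply: (fintype.subsetP (normal_norm nSG)).
  have [w hw ew] : exists2 w, w \in S & fingroup.repr (coset S u) = w * u.
    have := mem_repr_coset (coset S u); rewrite val_coset// => /rcosetP[w hw ew].
    by exists w.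
  have /GXP[A hA eA] := hu.
  rewrite val_insubd ew conj_pairM eA (SX_fixes hw hA) -eA ifT//.
  by apply/code_VeechP; exists u.
have lift a : a \in G / S -> exists2 u, u \in G & a = coset S u.
  by move=> /morphimP[u nu hu ->]; exists u.
exists Phi; split.
- exact: PhiE.
- move=> _ _ /lift[u hu ->] /lift[w hw ->]; apply: val_inj.
  have nu : u \in 'N(S) by apply: (fintype.subsetP (normal_norm nSG)).
  have nw : w \in 'N(S) by apply: (fintype.subsetP (normal_norm nSG)).
  rewrite -morphM// PhiE ?groupM//; apply/esym.
  by apply: opE => //; exact: PhiE.
- move=> _ _ /lift[u hu ->] /lift[w hw ->] /(congr1 val); rewrite !PhiE// => eq_uw.
  have nw : w \in 'N(S) by apply: (fintype.subsetP (normal_norm nSG)).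
  have nu : u \in 'N(S) by apply: (fintype.subsetP (normal_norm nSG)).
  (* Passing to left cosets reduces the claim to [w^-1 * u] fixing the base code. *)
  apply/rcoset_kercosetP => //; rewrite norm_rlcoset// mem_lcoset.
  rewrite [_ \in _]SXE conj_pairM; apply/eqP/(@conj_pair_inj n w).
  by rewrite -!conj_pairM ?mulgA mulgV mul1g.
- move=> c; exists (coset S (root c)); last by apply: val_inj; rewrite PhiE.
  by apply: mem_quotient; exact: rootG.
Qed.
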